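(* Let $\mathcal{R}$ be a finite subdivision rule with bounded valence and mesh approaching $0$, let $X$ be an expansion complex for $\mathcal{R}$, and let $S$ be a seed for $X$. Then the growth series $\sum_{n=0}^{\infty} b_n z^n$ for $(X,S)$ with respect to the fat path norm has polynomial growth; that is, $\limsup_{n\to\infty}\frac{\ln(b_n)}{\ln(n)}$ is a (finite) real number, where $b_n$ is the number of tiles of $X$ with fat path norm at most $n$.
   Context: Finite subdivision rule: a finite subdivision rule $\mathcal{R}$ consists of (1) a finite 2-dimensional CW complex $S_{\mathcal{R}}$, (2) a subdivision $\mathcal{R}(S_{\mathcal{R}})$ of $S_{\mathcal{R}}$, and (3) a continuous cellular map $\sigma_{\mathcal{R}}\colon \mathcal{R}(S_{\mathcal{R}})\to S_{\mathcal{R}}$ whose restriction to every open cell is a homeomorphism onto an open cell. It is required that $S_{\mathcal{R}}$ is the union of its closed 2-cells and that each closed 2-cell is the image of a polygon with at least three edges (called its tile type, with the cell structure having its vertices, its edges and its one face as cells) under a continuous cellular map whose restriction to each open cell is a homeomorphism. $\mathcal{R}$-complex: a 2-dimensional CW complex $X$ which is the union of its closed 2-cells, together with a structure map $f\colon X\to S_{\mathcal{R}}$, which is a continuous cellular map whose restriction to each open cell is a homeomorphism onto an open cell. The subdivision $\mathcal{R}(S_{\mathcal{R}})$ pulls back under $f$ to a subdivision $\mathcal{R}(X)$ of $X$, which is an $\mathcal{R}$-complex with structure map $\sigma_{\mathcal{R}}\circ f$. Recursively, $\mathcal{R}^{n+1}(X)=\mathcal{R}(\mathcal{R}^n(X))$.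 In particular $S_{\mathcal{R}}$ (with the identity map) and each tile type (with its map to $S_{\mathcal{R}}$) are $\mathcal{R}$-complexes. The tiles of an $\mathcal{R}$-complex are its closed 2-cells. Bounded valence: there is a finite upper bound, independent of $n$, for the valences of all vertices of the complexes $\mathcal{R}^n(t)$, for all $n\ge 0$ and all tile types $t$. Mesh approaching $0$: for every open cover $\mathcal{U}$ of $S_{\mathcal{R}}$ there is a positive integer $n$ such that every tile of $\mathcal{R}^n(S_{\mathcal{R}})$ is contained in some element of $\mathcal{U}$. Expansion complex: an expansion complex for $\mathcal{R}$ is an $\mathcal{R}$-complex $X$, with structure map $f$, which is homeomorphic to $\mathbb{R}^2$ and for which there is an orientation-preserving homeomorphism $\varphi\colon X\to X$ (the expansion map) such that $\sigma_{\mathcal{R}}\circ f=f\circ\varphi$. A seed of $X$ is a subcomplex $S\subset X$ which is a closed topological disk such that $S\subset\varphi(S)$ and $X=\bigcup_{n=0}^{\infty}\varphi^n(S)$. Fat path norm: for a tile $t$ of $X$, $|t|=0$ if $t$ is in $S$; if $t$ is not in $S$, then $|t|$ is the minimal positive integer $n$ such that there exist tiles $t_0,\dots,t_n$ of $X$ with $t_0$ in $S$, $t_n=t$, and $t_i\cap t_{i-1}$ containing an edge for $1\le i\le n$. Growth series: with $b_n=\#\{\text{tiles } t\subset X: |t|\le n\}$, the growth series for $(X,S)$ is $\sum_{n=0}^\infty b_nz^n$. It has polynomial growth of degree $d$ (a real number) if $d=\limsup_{n\to\infty}\frac{\ln(b_n)}{\ln(n)}$, and it has polynomial growth if it has polynomial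 growth of some degree $d$. *)

(* Defs.v *)
From HB Require Import structures.
From mathcomp Require Import all_boot all_order all_algebra.
From mathcomp Require Import finmap.
From mathcomp Require Import all_classical all_reals all_analysis.

Set Implicit Arguments.
Unset Strict Implicit.
Unset Printing Implicit Defensive.

Import Order.TTheory GRing.Theory Num.Theory.
Import numFieldNormedType.Exports.

Local Open Scope classical_set_scope.
Local Open Scope card_scope.
Local Open Scope ring_scope.

Section Homeomorphisms.
Variables T U : topologicalType.

Definition homeo_on (A : set T) (B : set U) (f : T -> U) : Prop :=
  [/\ set_bij A B f,
      {within A, continuous f} &
      exists2 g : U -> T,
        (forall x, A x -> g (f x) = x) & {within B, continuous g}].

Definition mutually_inverse_homeos (f : T -> U) (g : U -> T) : Prop :=
  [/\ continuous f, continuous g, cancel f g & cancel g f].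

End Homeomorphisms.

Section Euclidean.
Variable R : realType.

Definition normsq k (x : 'rV[R]_k) : R := \sum_i x 0 i ^+ 2.

Definition cdisk k : set 'rV[R]_k := [set x | normsq x <= 1].
Definition odisk k : set 'rV[R]_k := [set x | normsq x < 1].
Definition sphere k : set 'rV[R]_k := [set x | normsq x = 1].

Definition unit_vec (a : R) : 'rV[R]_2 :=
  \row_j (if j == 0 then cos a else sin a).

(* A homeomorphism of the plane preserves orientation when it has local degree
   +1, i.e., when the image of every positively oriented circle winds exactly
   once, positively, around the image of its center; [theta] is a continuous
   determination of the argument along the image of the circle. *)
Definition orientation_preserving_plane (g : 'rV[R]_2 -> 'rV[R]_2) : Prop :=
  forall (p : 'rV[R]_2) (r : R), 0 < r ->
  exists rho theta : R -> R,
    [/\ {within `[0, 2 * pi], continuous theta},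
        (forall s, 0 <= s <= 2 * pi ->
          0 < rho s /\
          g (p + r *: unit_vec s) - g p = rho s *: unit_vec (theta s)) &
        theta (2 * pi) = theta 0 + 2 * pi].

End Euclidean.

Arguments cdisk : clear implicits.
Arguments odisk : clear implicits.
Arguments sphere : clear implicits.

(* A cell structure is recorded by its open cells: [K k] is the set of open
   k-cells. Characteristic maps are required to exist in [cw2_complex] but are
   not part of the data. *)
Definition cell_structure (T : Type) := nat -> set (set T).

Section CellComplexes.
Variable T : topologicalType.
Implicit Types (K L : cell_structure T) (A S t : set T).

Definition open_cells K : set (set T) := \bigcup_k K k.

Definition closed_cells K k : set (set T) := closure @` K k.

Definition skeleton K (k : nat) : set T :=
  \bigcup_(j in [set j | (j <= k)%N]) \bigcup_(e in K j) e.

Definition characteristic_map (R : realType) K k (e : set T)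
    (Phi : 'rV[R]_k -> T) : Prop :=
  [/\ {within cdisk R k, continuous Phi},
      homeo_on (odisk R k) e Phi &
      (exists C : set (set T),
        [/\ finite_set C,
            C `<=` \bigcup_(j in [set j | (j < k)%N]) K j &
            Phi @` sphere R k `<=` \bigcup_(c in C) c])].

(* CW complexes of dimension at most 2, in Whitehead's sense: closure
   finiteness is part of [characteristic_map], and the last clause is the weak
   topology. *)
Definition cw2_complex (R : realType) K : Prop :=
  [/\ hausdorff_space T,
      (forall k, (2 < k)%N -> K k = set0),
      (forall x, exists! e, open_cells K e /\ e x),
      (forall k e, K k e ->
        exists Phi : 'rV[R]_k -> T, characteristic_map K e Phi) &
      (forall A, (forall e, open_cells K e -> closed (A `&` closure e)) ->
        closed A)].

Definition union_of_closed_2cells K : Prop :=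
  \bigcup_(t in closed_cells K 2) t = setT.

Definition subdivides (R : realType) L K : Prop :=
  cw2_complex R L /\
  (forall c, open_cells L c -> exists2 e, open_cells K e & c `<=` e).

Definition subcomplex K A : Prop :=
  exists2 C : set (set T), C `<=` open_cells K &
    A = \bigcup_(e in C) e /\ (forall e, C e -> closure e `<=` A).

(* The edge-ends at the vertex [v]: a pair of an incident open edge and a bit,
   the bit being free exactly when the edge is a loop, so that a loop
   contributes two edge-ends. The valence of [v] is the cardinal of this
   set. *)
Definition edge_ends K (v : T) : set (set T * bool) :=
  [set h : set T * bool | [/\ K 1%N h.1, closure h.1 v &
             h.2 -> closure h.1 `\` h.1 = [set v]]].

End CellComplexes.

Section CellMaps.
Variables T U : topologicalType.

Definition cellular (K : cell_structure T) (L : cell_structure U)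
    (f : T -> U) : Prop :=
  forall k, f @` skeleton K k `<=` skeleton L k.

Definition cell_map (K : cell_structure T) (L : cell_structure U)
    (f : T -> U) : Prop :=
  [/\ continuous f, cellular K L f &
      forall e, open_cells K e ->
        exists2 c, open_cells L c & homeo_on e c f].

(* Pullback under [f] of a subdivision [L] of the target: each open cell [e]
   of the source, identified by [f] with an open cell of the target, is cut
   into the preimages of the open cells of [L] contained in [f @` e]. *)
Definition pullback_cells (K : cell_structure T) (L : cell_structure U)
    (f : T -> U) : cell_structure T :=
  fun k => [set A | exists e c,
    [/\ open_cells K e, L k c, c `<=` f @` e & A = e `&` f @^-1` c]].

End CellMaps.

Section Polygon.
Variables (R : realType) (n : nat).

(* The regular n-gon inscribed in the unit circle. *)
Definition polygon_vertex (i : 'I_n) : 'rV[R]_2 :=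
  unit_vec (2 * pi * i%:R / n%:R).

Definition polygon : set 'rV[R]_2 :=
  [set x | exists w : 'I_n -> R,
    [/\ (forall i, 0 <= w i), \sum_i w i = 1 &
        x = \sum_i w i *: polygon_vertex i]].

(* Relative interior of the convex hull of the vertices indexed by [J]. *)
Definition open_hull (J : {set 'I_n}) : set 'rV[R]_2 :=
  [set x | exists w : 'I_n -> R,
    [/\ (forall i, if i \in J then 0 < w i else w i == 0), \sum_i w i = 1 &
        x = \sum_i w i *: polygon_vertex i]].

Definition polygon_cells : cell_structure polygon := fun k =>
  match k with
  | 0 => [set A | exists i : 'I_n, A = set_val @^-1` open_hull [set i]%SET]
  | 1 => [set A | exists i : 'I_n,
                    A = set_val @^-1` open_hull [set i; ordS i]%SET]
  | 2 => [set set_val @^-1` open_hull [set: 'I_n]%SET]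
  | _ => set0
  end.

End Polygon.

Arguments polygon : clear implicits.
Arguments polygon_cells : clear implicits.

(* The tile type of the closed 2-cell [closure e] is the polygon with
   [tile_size e] edges, mapped onto it by [tile_map e]; the values of these two
   fields are meaningful only when [e] is an open 2-cell. *)
Record subdivision_rule (R : realType) := SubdivisionRule {
  model :> topologicalType;
  model_cells : cell_structure model;
  model_sub : cell_structure model;
  sigma : model -> model;
  tile_size : set model -> nat;
  tile_map : forall e : set model, polygon R (tile_size e) -> model;
  model_cw : cw2_complex R model_cells;
  model_finite : finite_set (open_cells model_cells);
  model_union : union_of_closed_2cells model_cells;
  model_subdivides : subdivides R model_sub model_cells;
  sigma_cell_map : cell_map model_sub model_cells sigma;
  tile_size_ge3 : forall e, model_cells 2%N e -> (3 <= tile_size e)%N;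
  tile_map_cell_map : forall e, model_cells 2%N e ->
    cell_map (polygon_cells R (tile_size e)) model_cells (@tile_map e);
  tile_map_range : forall e, model_cells 2%N e ->
    range (@tile_map e) = closure e
}.

Arguments model_cells {R} s.
Arguments model_sub {R} s.
Arguments sigma {R s}.
Arguments tile_size {R s}.
Arguments tile_map {R s} e.

Section SubdivisionRules.
Variables (R : realType) (F : subdivision_rule R).

Definition R_complex (T : topologicalType) (K : cell_structure T)
    (f : T -> F) : Prop :=
  [/\ cw2_complex R K, union_of_closed_2cells K &
      cell_map K (model_cells F) f].

(* The open cells of the n-th subdivision of the complex [K] with structure
   map [f]; its structure map is [sigma^n \o f]. *)
Fixpoint iter_subdivision (T : topologicalType) (n : nat)
    (K : cell_structure T) (f : T -> F) : cell_structure T :=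
  if n is n'.+1 then
    pullback_cells (iter_subdivision n' K f) (model_sub F)
      (iter n' sigma \o f)
  else K.

Definition bounded_valence : Prop :=
  exists M : nat, forall (n : nat) (e : set F), model_cells F 2%N e ->
  let Kn := iter_subdivision n (polygon_cells R (tile_size e))
              (tile_map e) in
  forall v, Kn 0%N [set v] -> edge_ends Kn v #<= `I_M.

Definition mesh_to_zero : Prop :=
  forall cover : set (set F),
    (forall U, cover U -> open U) -> \bigcup_(U in cover) U = setT ->
  exists2 n : nat, (0 < n)%N &
    forall t, closed_cells (iter_subdivision n (model_cells F) idfun) 2 t ->
      exists2 U, cover U & t `<=` U.

Variable X : topologicalType.
Variable K : cell_structure X.

(* The choice of the chart [h] is immaterial: conjugation by a homeomorphism
   of the plane does not affect being orientation preserving. *)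
Definition expansion_complex (f : X -> F) (phi : X -> X) : Prop :=
  [/\ R_complex K f,
      (exists phi', mutually_inverse_homeos phi phi'),
      (exists (h : X -> 'rV[R]_2) (h' : 'rV[R]_2 -> X),
        mutually_inverse_homeos h h' /\
        orientation_preserving_plane (h \o phi \o h')) &
      sigma \o f = f \o phi].

End SubdivisionRules.

Section Growth.
Variables (R : realType) (X : topologicalType) (K : cell_structure X).

Definition seed (phi : X -> X) (S : set X) : Prop :=
  [/\ subcomplex K S,
      (exists d : 'rV[R]_2 -> X, homeo_on (cdisk R 2) S d),
      S `<=` phi @` S &
      \bigcup_n (iter n phi @` S) = setT].

Variable S : set X.

Definition fat_path (n : nat) (t : set X) : Prop :=
  exists t_ : nat -> set X,
    [/\ (forall i, (i <= n)%N -> closed_cells K 2 (t_ i)),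
        t_ 0%N `<=` S,
        t_ n = t &
        (forall i, (i < n)%N ->
          exists2 a, closed_cells K 1 a & a `<=` t_ i `&` t_ i.+1)].

(* [fat_path_norm t n] states that |t| = n. *)
Definition fat_path_norm (t : set X) (n : nat) : Prop :=
  (t `<=` S /\ n = 0%N) \/
  [/\ ~ t `<=` S, (0 < n)%N, fat_path n t &
      forall m, (0 < m)%N -> fat_path m t -> (n <= m)%N].

Definition fat_ball (n : nat) : set (set X) :=
  [set t | closed_cells K 2 t /\ exists2 k, (k <= n)%N & fat_path_norm t k].

Definition growth_coef (n : nat) : nat := #|` fset_set (fat_ball n)|.

End Growth.

Arguments seed R {X} K phi S.

Definition polynomial_growth_of_degree (R : realType) (b : nat -> nat)
    (d : R) : Prop :=
  limn_esup (fun n => (ln (b n)%:R / ln n%:R)%:E) = d%:E.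

Definition polynomial_growth (R : realType) (b : nat -> nat) : Prop :=
  exists d : R, polynomial_growth_of_degree b d.

(* Main.v *)
Require Import Defs.
From mathcomp Require Import all_boot all_order all_algebra.
From mathcomp Require Import finmap.
From mathcomp Require Import all_classical all_reals all_analysis.
From mathcomp Require Import ring lra zify.

(** The tiles at fat path distance at most [n] from the seed are compared with
    the tiles reached from it by [n] steps between closed tiles that merely
    intersect ([near_tiles]).  This coarser notion of step contracts under the
    inverse [psi] of the expansion map: there is an [N] such that two steps
    between tiles become a single step between their [N]-th ancestors, the
    tiles that contain their images by the [N]-th iterate of [psi]
    ([contraction]).  A tile has a bounded number of [N]-th descendants and the
    ancestor of a tile of the seed is a tile of the seed, so that the number of
    tiles within [2r] steps is at most a constant times the number of tiles
    within [r] steps ([near_tiles_doubling]).  A monotone sequence with this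
    property is bounded by a power of [n].

    That ancestors exist is the fact that the expansion map carries the first
    subdivision of the complex onto the complex itself ([parent_subcell]).  It
    rests on [connected_over_cell]: a connected set that the structure map sends
    onto an open cell, and that lies over nothing else, is an open cell.

    The contraction holds for the following reason.  Let [e1] touch [e0] and
    [e2], and let [E0], [E1], [E2] be the ancestors.  The image [s] of [e1] in
    [E1] is small; its closure contains a point [x] of the closed tile [E0] and
    a point [y] of the closed tile [E2].  In the polygon of which [E1] is the
    image, the cells that come near enough to a given point all have that point
    in their closures, so that the closed cells carrying [x] and [y] have a
    common point ([localizing_tile]).  As closed tiles are subcomplexes
    ([cell_sub_tile]), that point belongs to both closed tiles [E0] and [E2].

    Two things make this rigorous.  First, smallness is measured in the model
    complex, where the mesh hypothesis lives, by a cover adapted to the finite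
    fibres of the tile maps ([localizing_cover]); connectedness of [s] keeps it
    within one sheet over a member of the cover.  Second, the polygon of a tile
    must map to the complex and not only to the model.  The structure map
    identifies the open tile with the interior of the polygon, and this
    identification extends to the boundary because the structure map is
    finite-to-one on the closed tile: near a boundary point the values form
    connected sets, which can accumulate at finitely many points only
    ([lift_extension], [tile_lift]). *)

Set Implicit Arguments.
Unset Strict Implicit.
Unset Printing Implicit Defensive.

Import Order.TTheory GRing.Theory Num.Theory.
Import numFieldNormedType.Exports.

Local Open Scope classical_set_scope.
Local Open Scope ring_scope.

(** * Topology of discs and of cells *)

Section Euclid.
Variable R : realType.

Lemma cvg_rsum (I : Type) (T : Type) (F : set_system T) {FF : Filter F}
    (r : seq I) (P : pred I) (f : I -> T -> R) (l : I -> R) :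
  (forall i, P i -> f i @ F --> l i) ->
  (fun x => \sum_(i <- r | P i) f i x) @ F --> \sum_(i <- r | P i) l i.
Proof. by move=> h; apply: cvg_big => //; exact: add_continuous. Qed.

Lemma continuous_normsq k : continuous (@normsq R k).
Proof.
move=> x; apply: (@cvg_rsum _ _ (nbhs x) _ _ xpredT
  (fun i (y : 'rV[R]_k) => y 0 i ^+ 2) (fun i => x 0 i ^+ 2)) => i _.
by rewrite expr2; under eq_fun do rewrite expr2; apply: cvgM; exact: coord_continuous.
Qed.

Lemma cdisk_compact k : compact (cdisk R k).
Proof.
apply: (@subclosed_compact _ _
  [set v : 'rV[R]_k | forall i, `[-1, 1]%classic (v ord0 i)]).
- rewrite (_ : cdisk R k = @normsq R k @^-1` [set x | x <= 1]) //.
  apply: closed_comp; last exact: closed_le.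
  by move=> x _; exact: continuous_normsq.
- apply: (@rV_compact R k (fun=> `[(-1 : R), 1]%classic)) => i.
  exact: segment_compact.
- move=> x; rewrite /cdisk /= /normsq => x1 i; rewrite in_itv /= -ler_norml.
  rewrite -(@ler_sqr _ `|x ord0 i|) ?nnegrE //= expr1n real_normK ?num_real //.
  apply: le_trans x1; rewrite (bigD1 i) //= lerDl.
  by apply: sumr_ge0 => j _; exact: sqr_ge0.
Qed.

Definition convex_in (V : lmodType R) (A : set V) : Prop :=
  forall x y (t : R), A x -> A y -> 0 <= t <= 1 -> A (x + t *: (y - x)).

Lemma convex_connected (V : normedModType R) (A : set V) :
  convex_in A -> connected A.
Proof.
move=> cA; have [->|/set0P[x Ax]] := eqVneq A set0; first exact: connected0.
have -> : A = \bigcup_(y in A) ((fun t : R => x + t *: (y - x)) @` `[0, 1]).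
  apply/seteqP; split => [y Ay|z [y Ay [t]]] /=; last first.
    by rewrite in_itv /= => t01 <-; exact: cA.
  exists y => //; exists 1; first by rewrite /= in_itv /= ler01 lexx.
  by rewrite scale1r addrC subrK.
apply: bigcup_connected.
  exists x => y Ay; exists 0; first by rewrite /= in_itv /= ler01 lexx.
  by rewrite scale0r addr0.
move=> y Ay; apply: connected_continuous_connected; first exact: segment_connected.
apply: continuous_subspaceT => t; apply: cvgD; first exact: cvg_cst.
by apply: cvgZr_tmp; exact: cvg_id.
Qed.

Lemma odisk_convex k : convex_in (odisk R k).
Proof.
move=> x y t; rewrite /odisk /= /normsq => x1 y1 /andP[t0 t1].
have h : \sum_i (x + t *: (y - x)) 0 i ^+ 2 <=
    (1 - t) * (\sum_i x 0 i ^+ 2) + t * (\sum_i y 0 i ^+ 2).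
  rewrite !mulr_sumr -big_split /=; apply: ler_sum => i _; rewrite !mxE.
  have : 0 <= (1 - t) * t * (x 0 i - y 0 i) ^+ 2.
    apply: mulr_ge0; last exact: sqr_ge0.
    by apply: mulr_ge0 => //; rewrite subr_ge0.
  nra.
apply: le_lt_trans h _.
set X := \sum_i x 0 i ^+ 2 in x1 *; set Y := \sum_i y 0 i ^+ 2 in y1 *.
have [XY|YX] := leP X Y; [apply: le_lt_trans y1|apply: le_lt_trans x1].
  have : 0 <= (1 - t) * (Y - X) by apply: mulr_ge0; rewrite subr_ge0.
  by lra.
have : 0 <= t * (X - Y) by apply: mulr_ge0 => //; rewrite subr_ge0 ltW.
by lra.
Qed.

Lemma odisk_connected k : connected (odisk R k).
Proof. by apply: convex_connected; exact: odisk_convex. Qed.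

Lemma odisk0 k : odisk R k 0.
Proof.
by rewrite /odisk /= /normsq big1 ?ltr01 // => i _; rewrite mxE expr0n.
Qed.

End Euclid.

(** * Cells of a CW complex *)

Section CW.
Variables (R : realType) (T : topologicalType) (K : cell_structure T).
Hypothesis cwK : cw2_complex R K.

Lemma cw_hausdorff : hausdorff_space T. Proof. by case: cwK. Qed.

Lemma cell_of (x : T) : exists2 e, open_cells K e & e x.
Proof. by case: cwK => _ _ /(_ x)[e [[? ?] _]] _ _; exists e. Qed.

Lemma cell_uniq e e' x : open_cells K e -> open_cells K e' -> e x -> e' x ->
  e = e'.
Proof.
case: cwK => _ _ /(_ x)[e0 [_ U]] _ _ Ke Ke' ex e'x.
by rewrite -(U e) // -(U e').
Qed.

Lemma cw_weak A : (forall e, open_cells K e -> closed (A `&` closure e)) ->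
  closed A.
Proof. by case: cwK => _ _ _ _ /(_ A). Qed.

Lemma cell_facts k e : K k e ->
  [/\ e !=set0, connected e, compact (closure e) &
   exists C, [/\ finite_set C, C `<=` \bigcup_(j in [set j | (j < k)%N]) K j &
     closure e `<=` e `|` \bigcup_(c in C) c]].
Proof.
case: cwK => hT _ _ charK _ Kke.
have [Phi [Pc [[Pf _ Ps] Pc' _] [C [Cf CK CS]]]] := charK _ _ Kke.
have eE : Phi @` odisk R k = e.
  by apply/seteqP; split => [_ [x ox <-]|x /Ps//]; exact: Pf.
have cP : compact (Phi @` cdisk R k).
  by apply: continuous_compact => //; exact: cdisk_compact.
have cls : closure e `<=` Phi @` cdisk R k.
  rewrite closureE; apply: smallest_sub; first exact: compact_closed.
  by rewrite -eE; apply: image_subset => x; rewrite /odisk /= => /ltW.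
split.
- by exists (Phi 0); apply: Pf; exact: odisk0.
- by rewrite -eE; apply: connected_continuous_connected => //; exact: odisk_connected.
- by apply: subclosed_compact cls => //; exact: closed_closure.
- exists C; split => // y /cls [x]; rewrite /cdisk /= le_eqVlt => /orP[/eqP x1|x1] <-.
    by right; apply: CS; exists x.
  by left; apply: Pf.
Qed.

Lemma cell_nonempty e : open_cells K e -> e !=set0.
Proof. by case=> k _ /cell_facts[]. Qed.

Lemma cell_connected e : open_cells K e -> connected e.
Proof. by case=> k _ /cell_facts[]. Qed.

Lemma cell_compact e : open_cells K e -> compact (closure e).
Proof. by case=> k _ /cell_facts[]. Qed.

Lemma cell_finite_closure e : open_cells K e ->
  exists2 C, finite_set C &
    C `<=` open_cells K /\ closure e `<=` \bigcup_(c in C) c.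
Proof.
move=> Ke; have [k _ /[dup] Kke /cell_facts[_ _ _ [C [Cf CK CS]]]] := Ke.
exists (e |` C); first by rewrite finite_setU; split => //; exact: finite_set1.
split=> [c [->//|/CK [j _ Kjc]]|x /CS]; first by exists j.
by move=> [ex|[c Cc cx]]; [exists e => //; left|exists c => //; right].
Qed.

(** A set with one point in each cell of a family is closed by the weak
    topology, and so are its subsets, hence it has no cluster point; an infinite
    one inside a compact set would have some. *)
Lemma compact_finite_cells (A : set T) : compact A ->
  finite_set [set e | open_cells K e /\ e `&` A !=set0].
Proof.
move=> cA; set D := [set e | _]; apply: contrapT => Dinf.
have ptP (e : set T) : exists x, D e -> (e `&` A) x.
  have [[_ [x exA]]|nD] := pselect (D e); first by exists x.
  have [x _] : A !=set0.
    apply: contrapT => /nonemptyPn A0; apply: Dinf.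
    suff -> : D = set0 by exact: finite_set0.
    by rewrite -subset0 => e' [_]; rewrite A0 setI0 => -[].
  by exists x.
have [pt ptE] := choice ptP.
(* The filter of the cofinite parts of the chosen points. *)
pose F := filter_from [set D' : set (set T) | finite_set D']
  (fun D' => pt @` (D `\` D')).
have FF : ProperFilter F.
  apply: filter_from_proper.
    apply: filter_from_filter; first by exists set0; exact: finite_set0.
    move=> i j fi fj; exists (i `|` j); first by rewrite /= finite_setU.
    move=> _ [e [De nij] <-]; split; exists e => //; split => // h; apply: nij.
      by left.
    by right.
  move=> D' fD'; have [e De] : D `\` D' !=set0.
    apply: contrapT => /nonemptyPn; rewrite setD_eq0 => /sub_finite_set.
    by move=> /(_ fD').
  by exists (pt e); exists e.
have FA : F A.
  exists set0; first exact: finite_set0.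
  by move=> _ [e [De _] <-]; case: (ptE e De).
have [x [Ax clx]] := cA F FF FA.
have [ex Kex exx] := cell_of x.
pose Z := pt @` (D `\ ex).
have cZ : closed Z.
  apply: cw_weak => e Ke; have [C fC [CK eC]] := cell_finite_closure Ke.
  have /accessible_finite_set_closed : accessible_space T.
    by apply: hausdorff_accessible; exact: cw_hausdorff.
  apply; apply: (@sub_finite_set _ _ (pt @` C)); last exact: finite_image.
  move=> _ [[e' [De' _] <-] /eC [c Cc cpt]]; exists e' => //.
  have [e'pt _] := ptE _ De'.
  by rewrite (cell_uniq (proj1 De') (CK _ Cc) e'pt cpt).
have nZ : nbhs x (~` Z).
  apply: open_nbhs_nbhs; split; first exact: closed_openC.
  move=> [e [De /= nee] eq].
  have [ept _] := ptE _ De; rewrite eq in ept.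
  exact: nee (cell_uniq (proj1 De) Kex ept exx).
have FZ : F Z by exists [set ex] => //; exact: finite_set1.
by have [y [? ?]] := clx _ _ FZ nZ.
Qed.

(** Only finitely many cells meet a given closed cell, so on that closed cell
    the union agrees with a finite union of closed cells. *)
Lemma closed_cells_closed (Q : set (set T)) : Q `<=` open_cells K ->
  (forall e, Q e -> closure e `<=` \bigcup_(c in Q) c) ->
  closed (\bigcup_(c in Q) c).
Proof.
move=> QK Qcl; apply: cw_weak => e Ke.
set D := [set c | open_cells K c /\ c `&` closure e !=set0].
have fD : finite_set D by apply: compact_finite_cells; exact: cell_compact.
rewrite (_ : _ `&` _ = (\bigcup_(c in D `&` Q) closure c) `&` closure e).
  apply: closedI; last exact: closed_closure.
  apply: closed_bigcup; last by move=> *; exact: closed_closure.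
  by apply: sub_finite_set fD => ? [].
apply/seteqP; split => x [[c Qc cx] ex]; split => //.
  exists c; last exact: subset_closure.
  by split => //; split; [exact: QK|exists x].
by apply: (Qcl c) => //; case: Qc.
Qed.

End CW.

(** * Invariance of dimension and cells over a cell *)

Section WithinComp.
Variables T U V : topologicalType.

Lemma within_comp (A : set T) (B : set U) (f : T -> U) (g : U -> V) :
  {within A, continuous f} -> (forall x, A x -> B (f x)) ->
  {within B, continuous g} -> {within A, continuous (g \o f)}.
Proof.
move=> /subspace_continuousP cf fAB /subspace_continuousP cg.
apply/subspace_continuousP => x Ax W /= Wgf.
have := cg _ (fAB _ Ax) _ Wgf; rewrite /= /nbhs /= => h.
have := cf _ Ax _ h; rewrite /nbhs /= /within /= => h2.
near=> y => Ay; have := near h2 y; apply => //; exact: fAB.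
Unshelve. all: by end_near. Qed.

(** Continuous injections, between subsets; homeomorphic cells embed in each
    other, and this is all that comparing their dimensions requires. *)
Definition embeds (A : set T) (B : set U) : Prop :=
  exists f : T -> U, [/\ {within A, continuous f}, (forall x, A x -> B (f x)) &
    forall x y, A x -> A y -> f x = f y -> x = y].

Lemma homeo_embeds (A : set T) (B : set U) f : homeo_on A B f -> embeds A B.
Proof.
case=> -[fAB fi _] cf _; exists f; split => // x y Ax Ay; apply: fi; exact: mem_set.
Qed.

End WithinComp.

Lemma homeo_inv (T U : topologicalType) (A : set T) (B : set U) f :
  homeo_on A B f -> exists g : U -> T,
   [/\ forall x, A x -> g (f x) = x, forall y, B y -> A (g y) /\ f (g y) = y
     & {within B, continuous g}].
Proof.
case=> -[fAB _ fs] _ [g gf cg]; exists g; split => // y /fs [x Ax <-].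
by rewrite gf.
Qed.

Lemma homeo_embedsV (T U : topologicalType) (A : set T) (B : set U) f :
  homeo_on A B f -> embeds B A.
Proof.
move=> /homeo_inv [g [gf fg cg]]; exists g; split => // [y /fg []//|x y].
by move=> /fg [_ {2}<-] /fg [_ {2}<-] ->.
Qed.

Lemma embeds_trans (T U V : topologicalType) (A : set T) (B : set U) (C : set V) :
  embeds A B -> embeds B C -> embeds A C.
Proof.
move=> [f [cf fAB fi]] [g [cg gBC gi]]; exists (g \o f); split.
- exact: within_comp fAB cg.
- by move=> x /fAB /gBC.
- move=> x y Ax Ay /gi h; apply: fi => //; apply: h; exact: fAB.
Qed.

Section Dimension.
Variable R : realType.

Lemma unit_vecE (a : R) :
  unit_vec a = cos a *: delta_mx 0 0 + sin a *: delta_mx 0 1.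
Proof.
apply/rowP => j; rewrite !mxE /=; case: j => -[|[|//]] p;
  by rewrite /= ?mulr1 ?mulr0 ?addr0 ?add0r.
Qed.

Lemma continuous_unit_vec : continuous (@unit_vec R).
Proof.
move=> a; rewrite (_ : @unit_vec R =
  (fun a => cos a *: delta_mx 0 0 + sin a *: delta_mx 0 1)); last first.
  by apply/funext => b; exact: unit_vecE.
apply: cvgD; apply: cvgZr_tmp; [exact: continuous_cos|exact: continuous_sin].
Qed.

Lemma normsq_unit_vec (c a : R) : normsq (c *: unit_vec a) = c ^+ 2.
Proof.
rewrite /normsq big_ord_recl big_ord1 !mxE /= !exprMn -mulrDr.
by rewrite cos2Dsin2 mulr1.
Qed.

(** The difference of the values at antipodal points of a circle changes sign
    along a half turn, so a map from a disc to a line identifies two points. *)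
Lemma disk2_not_embeds1 : ~ embeds (odisk R 2) (odisk R 1).
Proof.
move=> [f [cf _ fi]].
pose u (c a : R) := c *: unit_vec a.
have ou c a : c ^+ 2 < 1 -> odisk R 2 (u c a).
  by rewrite /odisk /= normsq_unit_vec.
have cu c : c ^+ 2 < 1 -> continuous (fun a => f (u c a) 0 0).
  move=> c1 a.
  have cfu : continuous (f \o u c).
    apply/continuous_subspace_setT; apply: (@within_comp _ _ _ setT (odisk R 2)) => //.
      apply: continuous_subspaceT => b; apply: cvgZl_tmp; exact: continuous_unit_vec.
    by move=> *; exact: ou.
  exact: (@continuous_comp _ _ _ (f \o u c) (fun M : 'rV[R]_1 => M 0 0) a (cfu a)
    (@coord_continuous _ _ _ _ _ _)).
pose h a := f (u 2^-1 a) 0 0 - f (u (- 2^-1) a) 0 0.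
have c1 : (2^-1 : R) ^+ 2 < 1 by rewrite expr2; lra.
have c2 : (- 2^-1 : R) ^+ 2 < 1 by rewrite sqrrN.
have ch : continuous h by move=> a; apply: cvgB; exact: cu.
have hpi : h pi = - h 0.
  have e c : u c pi = u (- c) 0.
    rewrite /u; apply/rowP => j; rewrite !mxE; case: ifP => _.
      by rewrite cospi cos0; ring.
    by rewrite sinpi sin0; ring.
  by rewrite /h !e opprK opprB.
have [|||c _ hc] := @IVT R h 0 pi 0; first exact: pi_ge0.
- by apply: continuous_subspaceT => a; exact: ch.
- rewrite hpi ge_min le_max; have [h0|h0] := leP 0 (h 0); apply/andP; split; lra.
have /eqP : f (u 2^-1 c) = f (u (- 2^-1) c).
  by apply/rowP => j; rewrite ord1; apply/eqP; rewrite -subr_eq0; apply/eqP.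
move=> /eqP /fi => /(_ (ou _ _ c1) (ou _ _ c2)) e.
have : normsq (u 2^-1 c - u (- 2^-1) c) = 0.
  by rewrite e subrr /normsq big1 // => i _; rewrite mxE expr0n.
rewrite /u -scalerBl normsq_unit_vec opprK; lra.
Qed.

Lemma disk_not_embeds0 k : (0 < k <= 2)%N -> ~ embeds (odisk R k) (odisk R 0).
Proof.
move=> /andP[k0 k2] [f [_ _ fi]].
have o : odisk R k (const_mx 2^-1).
  rewrite /odisk /= /normsq; under eq_bigr do rewrite mxE.
  rewrite sumr_const card_ord; case: k k0 k2 {f fi} => [|[|[|//]]] // _ _.
    by rewrite mulr1n expr2; lra.
  by rewrite mulr2n expr2; lra.
have e := etrans (thinmx0 (f (const_mx 2^-1))) (esym (thinmx0 (f 0))).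
have /rowP/(_ (Ordinal k0)) := fi _ _ o (odisk0 _ _) e.
by rewrite !mxE; lra.
Qed.

Lemma disk_embeds_le j k : (k <= 2)%N -> embeds (odisk R k) (odisk R j) ->
  (k <= j)%N.
Proof.
move=> k2 kj; rewrite leqNgt; apply/negP => jk.
case: k j k2 jk kj => [|[|[|//]]] [|[|//]] // _ _.
- by apply: disk_not_embeds0.
- by apply: disk_not_embeds0.
- exact: disk2_not_embeds1.
Qed.

Lemma cw_dim_le2 (T : topologicalType) (K : cell_structure T) k e :
  cw2_complex R K -> K k e -> (k <= 2)%N.
Proof.
case=> _ h _ _ _ Kke; rewrite leqNgt; apply/negP => /h K0.
by rewrite K0 in Kke.
Qed.

Lemma homeo_cell_dim (T U : topologicalType) (K : cell_structure T)
    (L : cell_structure U) j k e d f :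
  cw2_complex R K -> cw2_complex R L -> K j e -> L k d -> homeo_on e d f ->
  j = k.
Proof.
move=> cK cL Kje Lkd hf.
have [_ _ _ /(_ _ _ Kje)[P [_ hP _]] _] := cK.
have [_ _ _ /(_ _ _ Lkd)[Q [_ hQ _]] _] := cL.
have ed := homeo_embeds hf; have de := homeo_embedsV hf.
have je := homeo_embeds hP; have ej := homeo_embedsV hP.
have kd := homeo_embeds hQ; have dk := homeo_embedsV hQ.
apply/eqP; rewrite eqn_leq; apply/andP; split; apply: disk_embeds_le.
- exact: cw_dim_le2 Kje.
- exact: embeds_trans je (embeds_trans ed dk).
- exact: cw_dim_le2 Lkd.
- exact: embeds_trans kd (embeds_trans de ej).
Qed.

Lemma cell_dim_uniq (T : topologicalType) (K : cell_structure T) j k e :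
  cw2_complex R K -> K j e -> K k e -> j = k.
Proof.
move=> cK Kje Kke; apply: (homeo_cell_dim cK cK Kje Kke (f := idfun)).
split; [by split => // x ex; exists x | |exists idfun => //];
  by apply: continuous_subspaceT => x; exact: cvg_id.
Qed.

Section OverCell.
Variables (T U : topologicalType) (K : cell_structure T) (L : cell_structure U).
Variable f : T -> U.
Hypotheses (cK : cw2_complex R K) (cL : cw2_complex R L) (hf : cell_map K L f).

Lemma cell_map_continuous : continuous f. Proof. by case: hf. Qed.

Lemma cell_over a d x : open_cells K a -> open_cells L d -> a x -> d (f x) ->
  homeo_on a d f.
Proof.
move=> Ka Ld ax dfx; have [_ _ /(_ _ Ka)[d' Ld' had]] := hf.
suff -> : d = d' by [].
by apply: (cell_uniq cL Ld Ld' dfx); case: had => -[+ _ _] _ _; apply.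
Qed.

Lemma cell_over_dim k a d x : open_cells K a -> L k d -> a x -> d (f x) ->
  K k a.
Proof.
move=> Ka Lkd ax dfx; have Ld : open_cells L d by exists k.
have had := cell_over Ka Ld ax dfx; have [j _ Kja] := Ka.
by rewrite -(homeo_cell_dim cK cL Kja Lkd had).
Qed.

(** Only cells of the dimension of [d] lie over [d], and each of them is both
    open and closed in the preimage of [d]. *)
Lemma connected_over_cell k d (B : set T) : L k d -> connected B ->
  f @` B = d -> K k B.
Proof.
move=> Lkd conB fB; have Ld : open_cells L d by exists k.
have [x0 Bx0] : B !=set0.
  by have [y] := cell_nonempty cL Ld; rewrite -fB => -[x Bx _]; exists x.
have Bd x : B x -> d (f x) by move=> Bx; rewrite -fB; exists x.
have [a Ka ax0] := cell_of cK x0.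
have Kka := cell_over_dim Ka Lkd ax0 (Bd _ Bx0).
have Bcell y : B y -> exists2 c, K k c & c y.
  move=> By; have [c Kc cy] := cell_of cK y.
  by exists c => //; exact: cell_over_dim cy (Bd _ By).
pose Q := [set c | (exists2 j, (j <= k)%N & K j c) /\ c <> a].
have Qcl : closed (\bigcup_(c in Q) c).
  apply: (closed_cells_closed cK) => [c [[j _ Kjc] _]|c [[j jk Kjc] nca] y cy].
    by exists j.
  have [_ _ _ [C [_ CK /(_ _ cy)]]] := cell_facts cK Kjc.
  move=> [c_y|[c' /CK [i /= ij Kic'] c'y]].
    by exists c => //; split => //; exists j.
  exists c' => //; split; first by exists i => //; exact: leq_trans (ltnW ij) jk.
  move=> c'a; rewrite c'a in Kic'; have ik := cell_dim_uniq cK Kic' Kka.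
  by rewrite ik ltnNge jk in ij.
(* [a] is open in the preimage of [d] as the complement of [Q], and closed there
   as the closure of [a] adds cells of lower dimension only. *)
have Ba : B `&` a = B.
  apply: conB; first by exists x0.
  - exists (~` \bigcup_(c in Q) c); first exact: closed_openC.
    apply/seteqP; split => y [By ay]; split => //.
      move=> [c [[j _ Kjc] nca] cy]; apply: nca.
      by apply: (cell_uniq cK _ _ cy ay); [exists j|exists k].
    have [c Kkc cy] := Bcell _ By; apply: contrapT => nay; apply: ay.
    exists c => //; split; first by exists k.
    by move=> ca; apply: nay; rewrite -ca.
  - exists (closure a); first exact: closed_closure.
    apply/seteqP; split => y [By ay]; split => //; first exact: subset_closure.
    have [_ _ _ [C [_ CK /(_ _ ay)]]] := cell_facts cK Kka.
    move=> [//|[c' /CK [i /= ij Kic'] c'y]].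
    have [c Kkc cy] := Bcell _ By.
    have cc' : c = c' by apply: (cell_uniq cK _ _ cy c'y); [exists k|exists i].
    rewrite -cc' in Kic'; have ik := cell_dim_uniq cK Kic' Kkc.
    by rewrite ik ltnn in ij.
suff -> : B = a by [].
apply/seteqP; split => [y|y ay]; first by rewrite -Ba => -[].
have [[fad fi _] _ _] := cell_over Ka Ld ax0 (Bd _ Bx0).
have : d (f y) by exact: fad.
rewrite -fB => -[z Bz fzy]; have az : a z by rewrite -Ba in Bz; case: Bz.
by rewrite -(fi _ _ (mem_set az) (mem_set ay) fzy).
Qed.

End OverCell.
End Dimension.

(** * The regular polygon and its cells *)

Section Subtype.
Variables (T : topologicalType) (A : set T).

Lemma set_val_continuous : continuous (set_val : A -> T).
Proof. exact: initial_continuous. Qed.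

Lemma nbhs_subtypeP (x : A) (U : set A) :
  nbhs x U <-> exists2 V, nbhs (set_val x) V & set_val @^-1` V `<=` U.
Proof.
split=> [|[V nV VU]].
  by case=> _ [[W oW <-] Wx WU]; exists W => //; exact: open_nbhs_nbhs.
by apply: filterS VU _; exact: (set_val_continuous nV).
Qed.

Lemma subtype_hausdorff : hausdorff_space T -> hausdorff_space A.
Proof.
move=> hT x y clxy; apply: val_inj; apply: hT => U V Ux Vy.
have [||z [Uz Vz]] := clxy (set_val @^-1` U) (set_val @^-1` V).
- exact: set_val_continuous.
- exact: set_val_continuous.
- by exists (set_val z).
Qed.

Lemma subtype_compact : compact A -> compact [set: A].
Proof.
move=> cA F FF _.
have GA : (set_val @ F) A.
  by apply: (@filterS _ F _ setT); [move=> x _; exact: set_valP|exact: filterT].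
have FG : ProperFilter (set_val @ F) by exact: fmap_proper_filter.
have [p [Ap clp]] := cA _ FG GA.
exists (exist _ p (mem_set Ap)); split => // U V FU /nbhs_subtypeP[W nW WV].
have FU' : (set_val @ F) (set_val @` U).
  by apply: (@filterS _ F _ U) => // x Ux; exists x.
have [_ [[x Ux <-] Wx]] := clp _ _ FU' nW.
by exists x; split => //; exact: WV.
Qed.

Lemma subtype_connected (B : set T) : B `<=` A -> connected B ->
  connected (set_val @^-1` B : set A).
Proof.
move=> BA cB; have [->|/set0P[x0 Bx0]] := eqVneq B set0.
  rewrite preimage_set0; exact: connected0.
pose a0 : A := exist _ x0 (mem_set (BA _ Bx0)).
pose r (x : T) : A := if pselect (A x) is left h then exist _ x (mem_set h) else a0.
have rE (a : A) : r (set_val a) = a.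
  rewrite /r; case: pselect => [h|[]]; last exact: set_valP.
  exact: val_inj.
have -> : set_val @^-1` B = r @` B.
  apply/seteqP; split => [a /= Ba|_ [x Bx <-]]; first by exists (set_val a).
  by rewrite /= /r; case: pselect => // nAx; case: nAx; exact: (BA x).
apply: connected_continuous_connected => //.
apply: (@continuous_subspaceW _ _ _ A) => //; apply/subspace_sigL_continuousP.
by rewrite (_ : sigL A r = id) => [x|]; [exact: cvg_id|apply/funext => a; exact: rE].
Qed.

End Subtype.

Section Polygon.
Variables (R : realType) (n : nat).
Hypothesis n_gt0 : (0 < n)%N.
Local Notation v := (@polygon_vertex R n).
Local Notation P := (polygon R n).

Lemma polygon_compact : compact P.
Proof.
pose D := [set w : 'rV[R]_n | forall i, `[0, 1]%classic (w ord0 i)] `&`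
  [set w | \sum_i w 0 i = 1].
have -> : P = (fun w : 'rV[R]_n => \sum_i w 0 i *: v i) @` D.
  apply/seteqP; split => [x [w [w0 w1 ->]]|_ [w [w01 w1] <-]].
    exists (\row_i w i); last by apply: eq_bigr => i _; rewrite mxE.
    split=> /=; last by under eq_bigr do rewrite mxE.
    move=> i; rewrite mxE in_itv /= w0 -w1 (bigD1 i) //= lerDl.
    exact: sumr_ge0.
  exists (fun i => w 0 i); split => // i.
  by have := w01 i; rewrite /= in_itv /= => /andP[].
apply: continuous_compact.
  apply: continuous_subspaceT => w.
  apply: (@cvg_big _ _ _ _ xpredT _ _ (nbhs w) _
    (fun i (w : 'rV[R]_n) => w 0 i *: v i)); first exact: add_continuous.
  by move=> i _; apply: cvgZr_tmp; exact: coord_continuous.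
apply: compact_closedI.
  apply: (@rV_compact R n (fun=> `[(0 : R), 1]%classic)) => i.
  exact: segment_compact.
rewrite (_ : (fun w : 'rV[R]_n => _) =
  (fun w : 'rV[R]_n => \sum_i w 0 i) @^-1` [set 1]) //.
apply: closed_comp; last first.
  apply: accessible_closed_set1; apply: hausdorff_accessible.
  exact: Rhausdorff.
move=> w _; apply: (@cvg_rsum _ _ _ (nbhs w) _ _ xpredT
   (fun i (w : 'rV[R]_n) => w 0 i)) => i _; exact: coord_continuous.
Qed.

Lemma polygonT_compact : compact [set: P].
Proof. exact: subtype_compact polygon_compact. Qed.

Lemma polygonT_hausdorff : hausdorff_space P.
Proof. by apply: subtype_hausdorff; exact: norm_hausdorff. Qed.

Lemma open_hull_sub J : @open_hull R n J `<=` P.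
Proof.
move=> x [w [w0 w1 ->]]; exists w; split => // i.
by have := w0 i; case: ifP => _; [move/ltW|move/eqP->].
Qed.

Lemma open_hull_convex J : convex_in (@open_hull R n J).
Proof.
move=> x y t [w [w0 w1 ->]] [w' [w'0 w'1 ->]] /andP[t0 t1].
exists (fun i => w i + t * (w' i - w i)); split.
- move=> i; have := w0 i; have := w'0 i; case: ifP => _.
    move=> a b; have [->|tn0] := eqVneq t 0; first by rewrite mul0r addr0.
    have : 0 < t * w' i by rewrite mulr_gt0 // lt_def tn0.
    have : 0 <= (1 - t) * w i by apply: mulr_ge0; [rewrite subr_ge0|exact: ltW].
    by lra.
  by move=> /eqP -> /eqP ->; rewrite subrr mulr0 addr0.
- by rewrite big_split /= -mulr_sumr sumrB w1 w'1 subrr mulr0 addr0.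
- rewrite -sumrB scaler_sumr -big_split /=; apply: eq_bigr => i _.
  by rewrite scalerDl -scalerA scalerBl.
Qed.

Lemma polygon_open_hull x : P x -> exists J, @open_hull R n J x.
Proof.
move=> [w [w0 w1 ->]]; exists [set i | w i != 0]%SET, w; split => // i.
by rewrite inE; case: eqVneq => //= h; rewrite lt_def h w0.
Qed.

Lemma polygon_cell_connected e : open_cells (polygon_cells R n) e -> connected e.
Proof.
case=> -[|[|[|//]]] _ /= => [[i ->]|[i ->]|->]; apply: subtype_connected;
  solve [exact: open_hull_sub | apply: convex_connected; exact: open_hull_convex].
Qed.

Lemma finite_polygon_cells : finite_set (open_cells (polygon_cells R n)).
Proof.
pose h := fun J : {set 'I_n} => set_val @^-1` (@open_hull R n J) : set P.
apply: (@sub_finite_set _ _ (h @` setT)); last exact/finite_image/finite_finset.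
by move=> e [[|[|[|//]]] _ /=] => [[i ->]|[i ->]|->];
  [exists [set i]%SET|exists [set i; ordS i]%SET|exists [set: 'I_n]%SET].
Qed.

Definition polygon_interior : set P := set_val @^-1` @open_hull R n [set: 'I_n]%SET.

(** Small balls cut the interior in convex sets, which are nonempty because the
    segment to the barycenter enters the interior at once. *)
Lemma polygon_interior_nbhs (x : P) (U : set P) : nbhs x U ->
  exists B, [/\ nbhs x B, B `<=` U, connected (B `&` polygon_interior) &
    B `&` polygon_interior !=set0].
Proof.
move=> /nbhs_subtypeP[V /nbhs_ballP[e /= e0 eV] VU].
set Be : set 'rV[R]_2 := ball (set_val x) e.
exists (set_val @^-1` Be); split.
- by apply/nbhs_subtypeP; exists Be => //; exact: nbhsx_ballx.
- by move=> y By; apply: VU; exact: eV.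
- rewrite /polygon_interior -preimage_setI; apply: subtype_connected.
    by move=> y [_]; exact: open_hull_sub.
  apply: convex_connected => y z t [By Hy] [Bz Hz] t01.
  split; last exact: open_hull_convex.
  move: By Bz; rewrite /Be -!ball_normE /ball_ /= => By Bz.
  have /andP[t0 t1] := t01.
  have -> : set_val x - (y + t *: (z - y)) =
      (1 - t) *: (set_val x - y) + t *: (set_val x - z).
    by rewrite scalerBl scale1r !scalerBr; apply/rowP => i; rewrite !mxE; ring.
  apply: le_lt_trans (ler_normD _ _) _; rewrite !normrZ (ger0_norm t0).
  rewrite ger0_norm ?subr_ge0 //.
  set a := `|_ - y| in By *; set b := `|_ - z| in Bz *.
  have a0 : 0 <= a by exact: normr_ge0.
  have b0 : 0 <= b by exact: normr_ge0.
  have [ab|ba] := leP a b.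
    apply: le_lt_trans Bz.
    have : 0 <= (1 - t) * (b - a) by apply: mulr_ge0; rewrite subr_ge0.
    by lra.
  apply: le_lt_trans By.
  have : 0 <= t * (a - b) by apply: mulr_ge0 => //; rewrite subr_ge0 ltW.
  by lra.
have nR : 0 < n%:R :> R by rewrite ltr0n.
pose c := \sum_i n%:R^-1 *: v i.
have [w [w0 w1 xE]] : P (set_val x) by exact: set_valP.
set m := `|c - set_val x|; have m0 : 0 <= m by exact: normr_ge0.
(* A ratio in ]0, 1] for which [t * m < e]. *)
pose t := e / (e + m).
have em0 : 0 < e + m by rewrite ltr_wpDr.
have t0 : 0 < t by rewrite divr_gt0.
have t1 : t <= 1 by rewrite ler_pdivrMr // mul1r lerDl.
pose y := set_val x + t *: (c - set_val x).
have Hy : @open_hull R n [set: 'I_n]%SET y.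
  exists (fun i => w i + t * (n%:R^-1 - w i)); split.
  - move=> i; rewrite inE.
    have : 0 < t * n%:R^-1 by rewrite mulr_gt0 // invr_gt0.
    have : 0 <= (1 - t) * w i by apply: mulr_ge0 => //; rewrite subr_ge0.
    by lra.
  - rewrite big_split /= -mulr_sumr sumrB w1 sumr_const card_ord.
    by rewrite -[X in X - 1]mulr_natr mulVf ?gt_eqF // subrr mulr0 addr0.
  - rewrite /y xE /c -sumrB scaler_sumr -big_split /=; apply: eq_bigr => i _.
    by rewrite [RHS]scalerDl -[in RHS](scalerA t) scalerBl.
exists (exist _ y (mem_set (open_hull_sub Hy))); split => //=.
rewrite /Be -ball_normE /ball_ /= /y opprD addNKr normrN normrZ gtr0_norm //.
by rewrite -/m /t mulrAC ltr_pdivrMr // mulrDr ltrDr ?mulr_gt0.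
Qed.

End Polygon.

Arguments polygon_interior : clear implicits.

(** * The cells of a polygon cover it *)

Section PolygonCover.
Variables (R : realType).

(** Twice the signed area of the triangle with vertices [a], [b], [c]. *)
Definition det3 (a b c : 'rV[R]_2) : R :=
  (b 0 0 - a 0 0) * (c 0 1 - a 0 1) - (c 0 0 - a 0 0) * (b 0 1 - a 0 1).

(** Cramer's rule. For four points in cyclic order on a circle all coefficients
    are positive, and the two sides meet where the diagonals cross. *)
Lemma det3_dependence (a b c d : 'rV[R]_2) :
  det3 b c d *: a + det3 a b d *: c = det3 a c d *: b + det3 a b c *: d.
Proof.
apply/rowP => j; rewrite !mxE.
have [->|->] : j = 0 \/ j = 1.
  by case: j => -[|[|//]] p; [left|right]; exact: val_inj.
- rewrite /det3; ring.
- rewrite /det3; ring.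
Qed.

Lemma det3_sum (a b c d : 'rV[R]_2) :
  det3 b c d + det3 a b d = det3 a c d + det3 a b c.
Proof. rewrite /det3; ring. Qed.

Lemma det3_unit_vec_gt0 (al be ga : R) : al < be -> be < ga ->
  ga < al + 2 * pi -> 0 < det3 (unit_vec al) (unit_vec be) (unit_vec ga).
Proof.
move=> ab bg ga'; pose p := (be - al) / 2; pose q := (ga - be) / 2.
have -> : be = al + (p + p) by rewrite /p; lra.
have -> : ga = al + ((p + q) + (p + q)) by rewrite /p /q; lra.
have p0 : 0 < sin p by apply: sin_gt0_pi; rewrite /p; lra.
have q0 : 0 < sin q by apply: sin_gt0_pi; rewrite /q; lra.
have pq0 : 0 < sin (p + q) by apply: sin_gt0_pi; rewrite /p /q; lra.
suff -> : det3 (unit_vec al) (unit_vec (al + (p + p)))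
    (unit_vec (al + (p + q + (p + q)))) = 4 * sin p * sin q * sin (p + q).
  by rewrite !mulr_gt0.
have c2 x : cos (x + x) = 1 - 2 * sin x ^+ 2 :> R.
  by rewrite cosD; have := cos2Dsin2 x; rewrite !expr2; lra.
have s2 x : sin (x + x) = 2 * sin x * cos x :> R by rewrite sinD; ring.
have -> : sin q = sin (p + q) * cos p - cos (p + q) * sin p.
  by rewrite -sinB; congr sin; ring.
rewrite /det3 /unit_vec !mxE /= !(cosD al) !(sinD al) !c2 !s2.
transitivity ((cos al ^+ 2 + sin al ^+ 2) * (4 * sin p *
    (sin (p + q) * cos p - cos (p + q) * sin p) * sin (p + q))); first by ring.
by rewrite cos2Dsin2 mul1r.
Qed.

Variable n : nat.
Local Notation v := (@polygon_vertex R n).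
Local Notation hull := (@open_hull R n).

Lemma vertex_crossing (a b c d : 'I_n) : (a < b)%N -> (b < c)%N -> (c < d)%N ->
  exists la lb lc ld : R, [/\ 0 < la /\ 0 < lc, 0 < lb /\ 0 < ld,
    la + lc = lb + ld & la *: v a + lc *: v c = lb *: v b + ld *: v d].
Proof.
move=> ab bc cd; exists (det3 (v b) (v c) (v d)), (det3 (v a) (v c) (v d)),
  (det3 (v a) (v b) (v d)), (det3 (v a) (v b) (v c)).
have n0 : 0 < n%:R :> R by rewrite ltr0n; exact: leq_ltn_trans (ltn_ord a).
have D (i j k : 'I_n) : (i < j)%N -> (j < k)%N -> 0 < det3 (v i) (v j) (v k).
  have lt_angle (x y : nat) : (x < y)%N ->
      2 * pi * x%:R / n%:R < 2 * pi * y%:R / n%:R :> R.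
    move=> xy; rewrite ltr_pM2r ?invr_gt0 // ltr_pM2l ?ltr_nat //.
    by rewrite mulr_gt0 // pi_gt0.
  move=> ij jk; apply: det3_unit_vec_gt0; try exact: lt_angle.
  have -> : 2 * pi * i%:R / n%:R + 2 * pi = 2 * pi * (i + n)%:R / n%:R :> R.
    by rewrite natrD; field; rewrite gt_eqF.
  by apply: lt_angle; rewrite (leq_trans (ltn_ord k)) // leq_addl.
by split; [split; apply: D|split; apply: D|exact: det3_sum|exact: det3_dependence];
  lia.
Qed.

(** The ends of an edge of the polygon; for [i < j] the negation says that
    [i] and [j] are the ends of a diagonal. *)
Definition adjacent (i j : nat) : bool :=
  [|| j == i.+1, i == j.+1, (i == 0%N) && (j == n.-1) | (j == 0%N) && (i == n.-1)].

Lemma diagonal_crossing (i j k : 'I_n) : (i < j)%N -> ~~ adjacent i j ->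
  k != i -> k != j ->
  exists (l : 'I_n) (li lj lk ll : R), [/\ [&& l != i, l != j & l != k],
    [&& 0 < li, 0 < lj, 0 < lk & 0 < ll], li + lj = lk + ll &
    li *: v i + lj *: v j = lk *: v k + ll *: v l].
Proof.
move=> ij nadj; rewrite -!val_eqE /= => ki kj.
have hi := ltn_ord i; have hj := ltn_ord j; have hk := ltn_ord k.
rewrite /adjacent in nadj.
have [kin|kout] := boolP (i < k < j)%N.
  have [jn|jn] := ltnP j.+1 n.
    pose l := Ordinal jn.
    have [||| x [y [z [w [[x0 z0] [y0 w0] s e]]]]] := @vertex_crossing i k j l;
      rewrite /=; try lia.
    exists l, x, z, y, w; split => //; last by rewrite x0 z0 y0 w0.
    rewrite -!val_eqE /=; lia.
  have n0 : (0 < n)%N by lia.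
  pose l := Ordinal n0.
  have [||| x [y [z [w [[x0 z0] [y0 w0] s e]]]]] := @vertex_crossing l i k j;
    rewrite /=; try lia.
  exists l, y, w, z, x; split; last by rewrite -e addrC.
  - rewrite -!val_eqE /=; lia.
  - by rewrite x0 z0 y0 w0.
  - lra.
have in1 : (i.+1 < n)%N by lia.
pose l := Ordinal in1.
have [kj'|jk] := ltnP j k.
  have [||| x [y [z [w [[x0 z0] [y0 w0] s e]]]]] := @vertex_crossing i l j k;
    rewrite /=; try lia.
  exists l, x, z, w, y; split; last by rewrite e addrC.
  - rewrite -!val_eqE /=; lia.
  - by rewrite x0 z0 y0 w0.
  - lra.
have [||| x [y [z [w [[x0 z0] [y0 w0] s e]]]]] := @vertex_crossing k i l j;
  rewrite /=; try lia.
exists l, y, w, x, z; split => //.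
- rewrite -!val_eqE /=; lia.
- by rewrite x0 z0 y0 w0.
Qed.

(** A representation with positive weights at the ends of a diagonal can be
    traded for one that also charges any other vertex, since diagonals on
    opposite sides cross. *)
Lemma open_hull_extend (J : {set 'I_n}) x (i j k : 'I_n) :
  hull J x -> i \in J -> j \in J -> (i < j)%N -> ~~ adjacent i j ->
  k \notin J -> exists2 J' : {set 'I_n}, hull J' x & (#|J| < #|J'|)%N.
Proof.
move=> [w [w0 w1 xE]] iJ jJ ij nadj kJ.
have ki : k != i by apply: contraNneq kJ => ->.
have kj : k != j by apply: contraNneq kJ => ->.
have ji : (j == i) = false by rewrite -val_eqE /=; lia.
have [l [li [lj [lk [ll [/and3P[l_i l_j l_k] /and4P[li0 lj0 lk0 ll0] s e]]]]]] :=
  diagonal_crossing ij nadj ki kj.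
have wi : 0 < w i by have := w0 i; rewrite iJ.
have wj : 0 < w j by have := w0 j; rewrite jJ.
(* Half of the largest multiple of the dependence that keeps the weights at [i]
   and [j] nonnegative. *)
pose eps := Num.min (w i / (2 * li)) (w j / (2 * lj)).
have e0 : 0 < eps by rewrite lt_min !divr_gt0 // mulr_gt0.
have ei : eps * li < w i.
  have : eps <= w i / (2 * li) by rewrite ge_min lexx.
  by rewrite ler_pdivlMr ?mulr_gt0 //; lra.
have ej : eps * lj < w j.
  have : eps <= w j / (2 * lj) by rewrite ge_min lexx orbT.
  by rewrite ler_pdivlMr ?mulr_gt0 //; lra.
pose dl (a b : 'I_n) : R := (a == b)%:R.
pose w' a := w a + eps * (lk * dl a k + ll * dl a l - li * dl a i - lj * dl a j).
have sumdl (V : lmodType R) (F : 'I_n -> V) c b : \sum_a (c * dl a b) *: F a = c *: F b.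
  rewrite (bigD1 b) //= big1 ?addr0 /dl ?eqxx ?mulr1 // => a /negbTE ->.
  by rewrite mulr0 scale0r.
have sumdlN (V : lmodType R) (F : 'I_n -> V) c b :
    \sum_a (- (c * dl a b)) *: F a = - (c *: F b).
  by under eq_bigr do rewrite scaleNr; rewrite sumrN sumdl.
have sumw' (V : lmodType R) (F : 'I_n -> V) : \sum_a w' a *: F a =
    \sum_a w a *: F a + eps *: (lk *: F k + ll *: F l - li *: F i - lj *: F j).
  rewrite /w'; under eq_bigr do rewrite scalerDl -scalerA !scalerDl.
  by rewrite big_split /= -scaler_sumr !big_split /= !sumdlN !sumdl.
exists (k |: (l |: J))%SET; last first.
  rewrite cardsU1 !inE negb_or (negbTE kJ) eq_sym l_k /= add1n ltnS.
  by apply: subset_leq_card; exact: finset.subsetUr.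
exists w'; split.
- move=> a; rewrite !inE; have := w0 a.
  have [->|ak] := eqVneq a k.
    rewrite (negbTE kJ) /= => /eqP wk0; rewrite /w' /dl eqxx (negbTE ki) (negbTE kj).
    rewrite wk0 eq_sym (negbTE l_k) /= mulr1n mulr0n.
    have := mulr_gt0 e0 lk0; lra.
  have [->|al] := eqVneq a l.
    move=> /= wl; have wl0 : 0 <= w l by case: ifP wl => _; [exact: ltW|move/eqP->].
    rewrite /w' /dl eqxx (negbTE l_i) (negbTE l_j) (negbTE l_k) /=.
    rewrite mulr1n mulr0n.
    have := mulr_gt0 e0 ll0; lra.
  rewrite /w' /dl (negbTE ak) (negbTE al) /= mulr0n.
  have [->|ai] := eqVneq a i.
    by rewrite iJ eq_sym ji /= mulr1n mulr0n; lra.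
  have [->|aj] := eqVneq a j; first by rewrite jJ /= mulr1n mulr0n; lra.
  by case: ifP => _; rewrite /= ?mulr0n; [lra|move/eqP->; apply/eqP; lra].
- have := sumw' R^o (fun=> 1); rewrite /GRing.scale /=.
  under eq_bigr do rewrite mulr1; move=> ->; under eq_bigr do rewrite mulr1.
  have z : lk + ll - li - lj = 0 by lra.
  by rewrite w1 !mulr1 z mulr0 addr0.
- rewrite sumw' -xE -addrA -opprD e subrr scaler0 addr0 //.
Qed.

(** Take a representation charging as many vertices as possible. Unless all
    vertices are charged, no two of them are the ends of a diagonal, by
    [open_hull_extend]; this leaves one vertex or the two ends of an edge. *)
Lemma polygon_cells_cover (x : polygon R n) : exists2 e,
  open_cells (polygon_cells R n) e & e x.
Proof.
have [J0 hJ0] := polygon_open_hull (set_valP x).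
have [J /asboolP hJ Jmax] := arg_maxnP (fun J : {set 'I_n} => #|J|)
  (asboolT hJ0 : (fun J => `[< hull J (set_val x) >]) J0).
have Jm (J' : {set 'I_n}) : hull J' (set_val x) -> (#|J'| <= #|J|)%N.
  by move=> h; apply: Jmax; exact/asboolP.
have [JT|JnT] := eqVneq J [set: 'I_n]%SET.
  by exists (set_val @^-1` hull [set: 'I_n]%SET); [exists 2%N|rewrite -JT].
have [k kJ] : exists k, k \notin J.
  apply/existsP; rewrite -negb_forall; apply: contra JnT => /forallP h.
  by apply/eqP/setP => k; rewrite inE h.
have adj (i j : 'I_n) : i \in J -> j \in J -> (i < j)%N -> adjacent i j.
  move=> iJ jJ ij; apply: contraT => nadj.
  have [J' /Jm] := open_hull_extend hJ iJ jJ ij nadj kJ.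
  by rewrite leqNgt => /negbTE ->.
have adj' (i j : 'I_n) : i \in J -> j \in J -> i != j -> adjacent i j.
  move=> iJ jJ; rewrite -val_eqE neq_ltn => /orP[ij|ji]; first exact: adj.
  have := adj _ _ jJ iJ ji; rewrite /adjacent; lia.
have [i iJ] : exists i, i \in J.
  apply/set0Pn; apply/eqP => J_0; have [w [w0 w1 _]] := hJ.
  suff : \sum_i w i = 0 by rewrite w1 => /eqP; rewrite oner_eq0.
  by apply: big1 => i _; apply/eqP; have := w0 i; rewrite J_0 inE.
have hk := ltn_ord k.
have J2 : (#|J| <= 2)%N.
  rewrite leqNgt; apply/negP => /card_gt2P[a [b [c [[aJ bJ cJ] [ab bc ca]]]]].
  have := adj' _ _ aJ bJ ab; have := adj' _ _ bJ cJ bc; have := adj' _ _ cJ aJ ca.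
  have : k != a by apply: contraNneq kJ => ->.
  have : k != b by apply: contraNneq kJ => ->.
  have : k != c by apply: contraNneq kJ => ->.
  move: ab bc ca; rewrite -!val_eqE /= /adjacent.
  have := ltn_ord a; have := ltn_ord b; have := ltn_ord c.
  lia.
have [/eqP Ji|J1] := eqVneq J [set i]%SET.
  exists (set_val @^-1` hull [set i]%SET); last by rewrite -(eqP Ji).
  by exists 0%N => //; exists i.
have [j jJ ji] : exists2 j, j \in J & j != i.
  have /subsetPn[j jJ] : ~~ (J \subset [set i]%SET).
    by apply: contra J1 => h; rewrite finset.eqEsubset h finset.sub1set.
  by rewrite inE; exists j.
have Jij : J = [set i; j]%SET.
  apply/esym/eqP; rewrite eqEcard finset.subUset !finset.sub1set iJ jJ /=.
  by rewrite cards2 eq_sym ji.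
have ordS_cell a : J = [set a; ordS a]%SET ->
    exists2 e, open_cells (polygon_cells R n) e & e x.
  move=> Ja; exists (set_val @^-1` hull [set a; ordS a]%SET); last by rewrite -Ja.
  by exists 1%N => //; exists a.
have hi := ltn_ord i; have hj := ltn_ord j.
have := adj' _ _ jJ iJ ji; move: ji; rewrite -val_eqE /= /adjacent => ji aij.
have [h|h] : (i.+1 %% n = j \/ j.+1 %% n = i)%N.
  move: aij; case/or4P => [/eqP h|/eqP h|/andP[/eqP j0 /eqP h]|/andP[/eqP j0 /eqP h]].
  - by right; rewrite modn_small -h.
  - by left; rewrite modn_small -h.
  - by left; rewrite h j0 prednK ?modnn //; lia.
  - by right; rewrite h j0 prednK ?modnn //; lia.
- apply: (ordS_cell i); rewrite Jij; congr [set _; _]%SET.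
  exact: val_inj.
- apply: (ordS_cell j); rewrite Jij finset.setUC; congr [set _; _]%SET.
  exact: val_inj.
Qed.

End PolygonCover.

(** * Extending a lift to the boundary *)

Section Lift.
Variables (P X U : topologicalType) (D : set P) (C : set X).
Variables (f : X -> U) (tau : P -> U) (g : P -> X).
Hypotheses (hX : hausdorff_space X) (hU : hausdorff_space U).
Hypothesis rX : regular_space X.
Hypotheses (cC : compact C) (cf : continuous f) (ctau : continuous tau).
Hypothesis cg : {within D, continuous g}.
Hypothesis gC : forall x, D x -> C (g x).
Hypothesis fg : forall x, D x -> f (g x) = tau x.
Hypothesis fibre : forall u, finite_set (C `&` f @^-1` [set u]).
Hypothesis locD : forall (x : P) (V : set P), nbhs x V -> exists B : set P,
  [/\ nbhs x B, B `<=` V, connected (B `&` D) & B `&` D !=set0].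

(** Near [w] the values of [g] accumulate inside the finite fibre of [f] over
    [tau w]. The images of small connected neighborhoods avoid the boundary of a
    neighborhood [O1] of one such point that excludes the others, so that they
    are trapped in [O1]. *)
Lemma lift_limit (w : P) : exists z : X, [/\ C z, f z = tau w &
  forall O : set X, nbhs z O -> exists2 B : set P, nbhs w B & g @` (B `&` D) `<=` O].
Proof.
pose G := g @ within D (nbhs w).
have FG : ProperFilter (within D (nbhs w)).
  apply: Build_ProperFilter_ex => B; rewrite /within /= => nB.
  have [B' [nB' B'B _ [y [B'y Dy]]]] := locD nB.
  by exists y; exact: B'B.
have GC : G C by apply: (@filterS _ _ _ D); [exact: gC|exact: withinT].
have [z [Cz clz]] := @cC G _ GC.
have fz : f z = tau w.
  apply: hU => V W nV nW.
  have GW : G (f @^-1` W).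
    have := ctau nW; rewrite /G /= /within /= /nbhs /=.
    by apply: filterS => y; rewrite /= => Wy Dy; rewrite fg.
  by have [y [Wy Vy]] := clz _ _ GW (cf nV); exists (f y).
exists z; split => // O nO.
pose Z := (C `&` f @^-1` [set tau w]) `\ z.
have fZ : finite_set Z by apply: sub_finite_set (fibre (tau w)) => ? [].
have sepP z' : exists A : set X, Z z' -> [/\ open A, A z & ~ closure A z'].
  have [Zz'|] := pselect (Z z'); last by exists set0.
  have zz' : z != z' by apply/eqP => zz'; case: Zz' => _; apply.
  move: hX; rewrite open_hausdorff => /(_ _ _ zz')[[A B] /= []].
  rewrite !inE => Az Bz' [oA oB AB0]; exists A => _; split => // clA.
  have [y] := clA _ (open_nbhs_nbhs (conj oB Bz')).
  by have -> : A `&` B = set0 := AB0.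
have [A hA] := choice sepP.
pose O1 := O° `&` \bigcap_(z' in Z) A z'.
have oO1 : open O1.
  apply: openI; first exact: open_interior.
  rewrite -[X in open X]setCK setC_bigcap; apply: closed_openC.
  apply: closed_bigcup => // z' /hA[oA _ _]; exact: open_closedC.
have O1z : O1 z.
  by split; [exact: nO|move=> z' /hA[]].
pose Q := f @` (C `&` (closure O1 `\` O1)).
have cQ : closed Q.
  apply: compact_closed => //; apply: continuous_compact.
    exact: continuous_subspaceT.
  apply: compact_closedI => //; apply: closedI; first exact: closed_closure.
  exact: open_closedC.
have nQ : nbhs (tau w) (~` Q).
  apply: open_nbhs_nbhs; split; first exact: closed_openC.
  move=> [z' [Cz' [clz' nz']] fz']; have Zz' : Z z'.
    by split => // zz'; apply: nz'; rewrite zz'.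
  have [_ _] := hA _ Zz'; apply; apply: closureS clz' => y [_]; exact.
have [B [nB BQ cB [b0 Bb0]]] := locD (ctau nQ).
exists B => //; have cgB : connected (g @` (B `&` D)).
  apply: connected_continuous_connected => //.
  by apply: continuous_subspaceW cg => ? [].
suff e : g @` (B `&` D) `&` O1 = g @` (B `&` D).
  by rewrite -e => y [_ [/interior_subset]].
have GB : G (g @` (B `&` D)).
  rewrite /G /= /within /=; apply: filterS nB => y By Dy /=; by exists y.
apply: cgB.
- by have [y [gy O1y]] := clz _ _ GB (open_nbhs_nbhs (conj oO1 O1z)); exists y.
- by exists O1.
- exists (closure O1); first exact: closed_closure.
  apply/seteqP; split => y [gy O1y]; split => //; first exact: subset_closure.
  apply: contrapT => nO1; have [b [Bb Db] bE] := gy.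
  apply: (BQ _ Bb); exists y; last by rewrite -bE fg.
  by split; [rewrite -bE; exact: gC|split].
Qed.

(** The pointwise limits are continuous because the target is regular. *)
Lemma lift_extension : exists G : P -> X, [/\ continuous G,
  forall w, f (G w) = tau w, forall w, C (G w) & forall w, D w -> G w = g w].
Proof.
have [G hG] := choice lift_limit; exists G; split; [|by move=> w; case: (hG w)..|].
  move=> w O nO; have [V nV VO] := @rX (G w) _ nO.
  have [_ _ /(_ _ nV)[B nB BV]] := hG w.
  have : nbhs w (nbhs^~ B) by exact: nbhs_interior.
  apply: filterS => w' nB'; apply: VO => A nA.
  have [_ _ /(_ _ nA)[B' nB'' BA]] := hG w'.
  have [B2 [_ B2B _ [y [B2y Dy]]]] := locD (filterI nB' nB'').
  have [By B'y] := B2B _ B2y.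
  by exists (g y); split; [apply: BV|apply: BA]; exists y.
move=> w Dw; apply: hX => V W nV nW.
have [_ _ /(_ _ nV)[B nB BV]] := hG w.
have /subspace_continuousP/(_ _ Dw _ nW) := cg; rewrite /= /within /= => nB'.
have nBB := filterI nB nB'.
have [B2 [_ B2B _ [y [B2y Dy]]]] := locD (nBB _).
have [By B'y] := B2B _ B2y.
by exists (g y); split; [apply: BV; exists y|exact: B'y].
Qed.

End Lift.

(** * Tiles as images of polygons *)

Lemma finite_injective_fibre (T U : Type) (D : set (set T)) (A : set T)
    (f : T -> U) u :
  finite_set D -> (forall x, A x -> exists2 e, D e & e x) ->
  (forall e x y, D e -> e x -> e y -> f x = f y -> x = y) ->
  finite_set (A `&` f @^-1` [set u]).
Proof.
move=> fD Dcov finj; have [->|/set0P[x0 _]] := eqVneq (A `&` f @^-1` [set u]) set0.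
  exact: finite_set0.
have ptP (e : set T) : exists x, (e `&` f @^-1` [set u]) !=set0 ->
    (e `&` f @^-1` [set u]) x.
  by have [[x h]|] := pselect ((e `&` f @^-1` [set u]) !=set0); [exists x|exists x0].
have [pt hpt] := choice ptP.
apply: (@sub_finite_set _ _ (pt @` D)); last exact: finite_image.
move=> x [Ax fx]; have [e De ex] := Dcov _ Ax; exists e => //.
have [|ept fpt] := hpt e; first by exists x.
by apply: (finj e) => //; rewrite fx.
Qed.

Section Tile.
Variables (R : realType) (F : subdivision_rule R).
Local Notation P c := (polygon R (@tile_size R F c)).

Lemma tile_size_gt0 c : model_cells F 2%N c -> (0 < @tile_size R F c)%N.
Proof. by move=> /tile_size_ge3; apply: leq_trans. Qed.

Lemma tile_map_continuous c : model_cells F 2%N c -> continuous (tile_map c).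
Proof. by move=> /tile_map_cell_map[]. Qed.

(** The interior of the polygon is dense, so the open cell that it covers has
    the open tile in its closure; being of maximal dimension, this open tile can
    only be that cell. *)
Lemma tile_map_interior c : model_cells F 2%N c ->
  homeo_on (polygon_interior R (tile_size c)) c (tile_map c).
Proof.
move=> Fc; have cF := model_cw F.
have [ct _ cellt] := tile_map_cell_map Fc.
have [|d [j _ Fjd] hd] := cellt (polygon_interior R (tile_size c)); first by exists 2%N.
suff cd : c = d by rewrite -cd in hd.
have [x cx] : c !=set0 by apply: (cell_nonempty cF); exists 2%N.
have xd : closure d x.
  have : closure c x by exact: subset_closure.
  rewrite -tile_map_range // => -[w _ <-] V /ct.
  move=> /(polygon_interior_nbhs (tile_size_gt0 Fc))[B [_ BV _ [y [By Iy]]]].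
  exists (tile_map c y); split; last exact: BV.
  by case: hd => -[+ _ _] _ _; apply.
have [_ _ _ [C [_ CK /(_ _ xd)]]] := cell_facts cF Fjd.
case=> [dx|[c' /CK [i /= ij Fic'] c'x]].
  by apply: (cell_uniq cF _ _ cx dx); [exists 2%N|exists j].
have cc' : c = c' by apply: (cell_uniq cF _ _ cx c'x); [exists 2%N|exists i].
rewrite -cc' in Fic'; have i2 := cell_dim_uniq cF Fic' Fc.
by have := leq_trans ij (cw_dim_le2 cF Fjd); rewrite i2 ltnn.
Qed.

Variables (X : topologicalType) (K : cell_structure X) (f : X -> F).
Hypothesis hK : R_complex K f.
Hypothesis rX : regular_space X.

Let cK : cw2_complex R K. Proof. by case: hK. Qed.
Let hf : cell_map K (model_cells F) f. Proof. by case: hK. Qed.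
Let cF : cw2_complex R (model_cells F). Proof. exact: model_cw. Qed.

Lemma cell_map_inj e x y : open_cells K e -> e x -> e y -> f x = f y -> x = y.
Proof.
case: hf => _ _ h /h [d _ [[_ fi _] _ _]] ex ey; apply: fi; exact: mem_set.
Qed.

Lemma tile_type E : K 2%N E -> exists2 c, model_cells F 2%N c & homeo_on E c f.
Proof.
move=> KE; case: hf => _ _ /(_ E)[|c [j _ Fjc] hE]; first by exists 2%N.
by exists c => //; rewrite (homeo_cell_dim cK cF KE Fjc hE).
Qed.

(** The polygon of a tile maps onto the closed tile: the lift of the interior
    extends to the boundary because [f] is finite-to-one on the closed tile. *)
Lemma tile_lift E : K 2%N E -> exists c, model_cells F 2%N c /\
  exists G : P c -> X, [/\ continuous G, forall w, f (G w) = tile_map c w,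
    range G = closure E, G @` polygon_interior R (tile_size c) = E &
    homeo_on E c f].
Proof.
move=> KE; have [c Fc hE] := tile_type KE; exists c; split => //.
have oKE : open_cells K E by exists 2%N.
have ht := tile_map_interior Fc.
have [h [hfE fhc ch]] := homeo_inv hE.
have [[tI ti ts] _ _] := ht.
have fib u : finite_set (closure E `&` f @^-1` [set u]).
  apply: (@finite_injective_fibre _ _
     [set e | open_cells K e /\ e `&` closure E !=set0]).
  - by apply: (compact_finite_cells cK); exact: (cell_compact cK).
  - move=> x Ex; have [e Ke ex] := cell_of cK x; exists e => //.
    by split => //; exists x.
  - by move=> e x y [Ke _]; exact: cell_map_inj.
have [G [cG fG GC Gg]] : exists G : P c -> X, [/\ continuous G,
    forall w, f (G w) = tile_map c w, forall w, closure E (G w) &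
    forall w, polygon_interior R (tile_size c) w -> G w = h (tile_map c w)].
  apply: lift_extension => //.
  - exact: (cw_hausdorff cK).
  - exact: (cw_hausdorff cF).
  - exact: (cell_compact cK).
  - exact: (cell_map_continuous hf).
  - exact: tile_map_continuous.
  - apply: (@within_comp _ _ _ _ c) => //.
    apply: continuous_subspaceT; exact: tile_map_continuous.
  - by move=> w /tI /fhc [hE' _]; exact: subset_closure.
  - by move=> w /tI /fhc [_].
  - by move=> w V; exact: (polygon_interior_nbhs (tile_size_gt0 Fc)).
have GI : G @` polygon_interior R (tile_size c) = E.
  apply/seteqP; split => [_ [w Iw <-]|x Ex].
    by rewrite Gg //; have [] := fhc _ (tI _ Iw).
  have /ts [w Iw wE] : c (f x) by case: hE => -[+ _ _] _ _; apply.
  by exists w => //; rewrite Gg // wE hfE.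
exists G; split => //; apply/seteqP; split => [_ [w _ <-] //|].
rewrite closureE; apply: smallest_sub; last by rewrite -{1}GI; exact: image_subset.
apply: compact_closed; first exact: (cw_hausdorff cK).
apply: continuous_compact; last exact: polygonT_compact.
exact: continuous_subspaceT.
Qed.

(** The image of an open cell of the polygon is connected and lies over an open
    cell of the model. *)
Lemma lift_cell c (G : P c -> X) k : model_cells F 2%N c -> continuous G ->
  (forall w, f (G w) = tile_map c w) ->
  open_cells (polygon_cells R (tile_size c)) k -> open_cells K (G @` k).
Proof.
move=> Fc cG fG hk; have [_ _ /(_ _ hk)[d [j _ Fjd] [[td _ ts] _ _]]] :=
  tile_map_cell_map Fc.
exists j => //; apply: (connected_over_cell cK cF hf Fjd).
  apply: connected_continuous_connected; first exact: polygon_cell_connected hk.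
  exact: continuous_subspaceT.
apply/seteqP; split => [_ [_ [w kw <-] <-]|x /ts [w kw <-]].
  by rewrite fG; exact: td.
by exists (G w) => //; exists w.
Qed.

(** A closed tile is a subcomplex, since it is the union of the images of the
    cells of its polygon. *)
Lemma cell_sub_tile E a : K 2%N E -> open_cells K a -> a `&` closure E !=set0 ->
  closure a `<=` closure E.
Proof.
move=> KE Ka [x [ax]]; have [c [Fc [G [cG fG GE _ _]]]] := tile_lift KE.
rewrite -GE => -[w _ wx]; rewrite closureE; apply: smallest_sub.
  by rewrite GE; exact: closed_closure.
have [k hk kw] := polygon_cells_cover w.
have Kk := lift_cell Fc cG fG hk.
suff -> : a = G @` k by exact: image_subset.
by apply: (cell_uniq cK Ka Kk ax); exists w.
Qed.

(** Connectedness of [A] matters: the preimage of a small set in a polygon may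
    come near several points, which the tile map identifies. *)
Definition localizing (U : set F) : Prop :=
  forall c, model_cells F 2%N c -> forall A : set (P c), connected A ->
  A !=set0 -> A `<=` tile_map c @^-1` U ->
  exists w, forall x, closure A x -> exists k,
    [/\ open_cells (polygon_cells R (tile_size c)) k, k x & closure k w].

(** The set [s] lifts to a connected set [A] in the interior of the polygon, near
    a point [w]. The points [x] and [y] lift to the closure of [A], and the image
    of [w] is common to the closures of their cells. *)
Lemma localizing_tile (U : set F) E s x y : localizing U -> K 2%N E ->
  s `<=` E -> connected s -> f @` s `<=` U -> closure s x -> closure s y ->
  exists a b, [/\ open_cells K a /\ a x, open_cells K b /\ b y &
    closure a `&` closure b !=set0].
Proof.
move=> locU KE sE cs fsU sx sy.
have [c [Fc [G [cG fG GE GI hE]]]] := tile_lift KE.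
have ht := tile_map_interior Fc.
have [h [hK' tc ch]] := homeo_inv ht.
have fsc : f @` s `<=` c.
  by move=> _ [z /sE Ez <-]; case: hE => -[+ _ _] _ _; apply.
pose A := h @` (f @` s).
have cA : connected A.
  apply: connected_continuous_connected.
    apply: connected_continuous_connected => //.
    by apply: continuous_subspaceT; exact: (cell_map_continuous hf).
  exact: continuous_subspaceW ch.
have GA : G @` A = s.
  have GhE z : s z -> G (h (f z)) = z.
    move=> sz; have fz : c (f z) by apply: fsc; exists z.
    have [Ih th] := tc _ fz.
    apply: (cell_map_inj (e := E)); [by exists 2%N| |exact: sE|by rewrite fG].
    by rewrite -GI; exists (h (f z)).
  apply/seteqP; split => [_ [_ [_ [z sz <-] <-] <-]|z sz]; first by rewrite GhE.
  by exists (h (f z)); [exists (f z) => //; exists z|exact: GhE].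
have A0 : A !=set0.
  have [z [sz _]] := sx _ filterT; by exists (h (f z)), (f z) => //; exists z.
have AU : A `<=` tile_map c @^-1` U.
  move=> _ [u [z sz <-] <-]; rewrite /=.
  have [|_ ->] := tc (f z); first by apply: fsc; exists z.
  by apply: fsU; exists z.
have [w hw] := locU c Fc A cA A0 AU.
have clA : closure s `<=` G @` closure A.
  rewrite closureE; apply: smallest_sub.
    apply: compact_closed; first exact: (cw_hausdorff cK).
    apply: continuous_compact; first exact: continuous_subspaceT.
    apply: (@subclosed_compact _ _ setT) => //; first exact: closed_closure.
    exact: polygonT_compact.
  by rewrite -GA; apply: image_subset; exact: subset_closure.
have Gcl k : closure k w -> closure (G @` k) (G w).
  by move=> kw V /cG /kw [p [kp Vp]]; exists (G p); split => //; exists p.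
have [p /hw[k [hk kp kw]] <-] := clA _ sx.
have [q /hw[l [hl lq lw]] <-] := clA _ sy.
exists (G @` k), (G @` l); split.
- by split; [exact: lift_cell|exists p].
- by split; [exact: lift_cell|exists q].
- by exists (G w); split; exact: Gcl.
Qed.

End Tile.

(** * The localizing cover *)

Section Cover.
Variables (R : realType) (F : subdivision_rule R).
Local Notation P c := (polygon R (@tile_size R F c)).

(** The fibre of the tile map over [z] is finite. The tile map avoids [z] outside
    small neighborhoods of the points of the fibre, and also on the boundaries of
    these neighborhoods; a connected set mapped close enough to [z] is therefore
    contained in one of them. *)
Lemma localizing_at c z : model_cells F 2%N c -> exists U : set F, [/\ open U, U z &
  forall A : set (P c), connected A -> A !=set0 -> A `<=` tile_map c @^-1` U ->
  exists w, forall x, closure A x -> exists k,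
    [/\ open_cells (polygon_cells R (tile_size c)) k, k x & closure k w]].
Proof.
move=> Fc; set n := tile_size c; have cF := model_cw F.
have hP : hausdorff_space (P c) by exact: polygonT_hausdorff.
have cP : compact [set: P c] by exact: polygonT_compact.
have cells_fin := @finite_polygon_cells R n.
pose Z := [set w | tile_map c w = z].
have fZ : finite_set Z.
  rewrite -(setTI Z); 
  apply: (@finite_injective_fibre _ _ _ setT (tile_map c) z cells_fin).
    by move=> x _; exact: polygon_cells_cover.
  move=> e x y hk ex ey.
  have [_ _ /(_ _ hk)[d _ [[_ ti _] _ _]]] := tile_map_cell_map Fc.
  by apply: ti; exact: mem_set.
have fin_closed (A : set (P c)) : finite_set A -> closed A.
  by move: A; apply/accessible_finite_set_closed; exact: hausdorff_accessible.
have nbP (w : P c) : exists W : set (P c), [/\ open W, W w,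
    forall w', Z w' -> closure W w' -> w' = w &
    forall x, closure W x -> exists k,
      [/\ open_cells (polygon_cells R n) k, k x & closure k w]].
  pose far := \bigcup_(k in open_cells (polygon_cells R n) `&`
    [set k | ~ closure k w]) closure k.
  have cfar : closed far.
    apply: closed_bigcup; last by move=> *; exact: closed_closure.
    by apply: sub_finite_set cells_fin => ? [].
  have cZ : closed (Z `\ w).
    by apply: fin_closed; apply: sub_finite_set fZ => ? [].
  have nw : nbhs w (~` (far `|` (Z `\ w))).
    apply: open_nbhs_nbhs; split; first by apply: closed_openC; exact: closedU.
    by case=> [[k [_ nk] kw]|[_]]; [exact: nk|apply].
  have [V nV VO] := compact_regular hP cP filterT nw.
  exists V°; split => [|//|w' Zw' /(closureS (@interior_subset _ V))/VO nw'|x].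
  - exact: open_interior.
  - by apply: contrapT => ww'; apply: nw'; right.
  - move=> /(closureS (@interior_subset _ V))/VO nx.
    have [k hk kx] := polygon_cells_cover x; exists k; split => //.
    apply: contrapT => nkw; apply: nx; left; exists k => //.
    exact: subset_closure.
have [W hW] := choice nbP.
pose bad := ~` (\bigcup_(w in Z) W w) `|` \bigcup_(w in Z) (closure (W w) `\` W w).
pose Q := tile_map c @` bad.
have cQ : closed Q.
  apply: compact_closed; first exact: (cw_hausdorff cF).
  apply: continuous_compact.
    by apply: continuous_subspaceT; exact: tile_map_continuous.
  apply: (@subclosed_compact _ _ setT) => //; apply: closedU.
    by apply: open_closedC; apply: bigcup_open => w _; case: (hW w).
  apply: closed_bigcup => // w _; apply: closedI; first exact: closed_closure.
  by apply: open_closedC; case: (hW w).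
exists (~` Q); split; first exact: closed_openC.
  move=> [w bw wz]; have Zw : Z w by [].
  have [_ Ww _ _] := hW w; case: bw => [|[w' Zw' [clw nw]]].
    by apply; exists w.
  have [_ Ww' /(_ _ Zw clw) ww' _] := hW w'; apply: nw; by rewrite ww'.
move=> A cA [a Aa] AQ.
have Agood y : A y -> ~ bad y by move=> Ay By; apply: (AQ _ Ay); exists y.
have [w Zw Wa] : (\bigcup_(w in Z) W w) a.
  by apply: contrapT => na; apply: (Agood _ Aa); left.
have [oW _ _ Wcell] := hW w.
have AW : A `&` W w = A.
  apply: cA; first by exists a.
  - by exists (W w).
  - exists (closure (W w)); first exact: closed_closure.
    apply/seteqP; split => y [Ay Wy]; split => //; first exact: subset_closure.
    by apply: contrapT => nWy; apply: (Agood _ Ay); right; exists w.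
exists w => x Ax; apply: Wcell; apply: closureS Ax.
by rewrite -AW; exact: subIsetr.
Qed.

Lemma localizing_cover (z : F) : exists U : set F,
  [/\ open U, U z & localizing U].
Proof.
have hU c : exists U : set F, model_cells F 2%N c -> [/\ open U, U z &
  forall A : set (P c), connected A -> A !=set0 -> A `<=` tile_map c @^-1` U ->
  exists w, forall x, closure A x -> exists k,
    [/\ open_cells (polygon_cells R (tile_size c)) k, k x & closure k w]].
  by have [/(localizing_at z)[U hU]|] := pselect (model_cells F 2%N c);
    [exists U|exists setT].
have [U UP] := choice hU.
exists (\bigcap_(c in model_cells F 2%N) U c); split.
- rewrite -[X in open X]setCK setC_bigcap; apply: closed_openC.
  apply: closed_bigcup => [|c /UP[? _ _]]; last exact: open_closedC.
  by apply: sub_finite_set (@model_finite _ F) => c Fc; exists 2%N.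
- by move=> c /UP[].
- move=> c Fc A cA A0 AU; have [_ _] := UP _ Fc; apply => // y /AU; exact.
Qed.

End Cover.

(** * Tiles under the expansion map *)

Section Expansion.
Variables (R : realType) (F : subdivision_rule R).
Variables (X : topologicalType) (K : cell_structure X) (f : X -> F).
Variables (phi psi : X -> X).
Hypothesis hK : R_complex K f.
Hypothesis cphi : continuous phi.
Hypotheses (phiK : cancel phi psi) (psiK : cancel psi phi).
Hypothesis sf : sigma \o f = f \o phi.

Let cK : cw2_complex R K. Proof. by case: hK. Qed.
Let hf : cell_map K (model_cells F) f. Proof. by case: hK. Qed.
Let cF : cw2_complex R (model_cells F). Proof. exact: model_cw. Qed.
Let cL : cw2_complex R (model_sub F). Proof. by case: (@model_subdivides _ F). Qed.

Lemma sf_pt x : sigma (f x) = f (phi x).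
Proof. by have /(congr1 (@^~ x)) := sf. Qed.

Lemma f_iter_phi n x : f (iter n phi x) = iter n sigma (f x).
Proof. by elim: n => //= n <-; rewrite sf_pt. Qed.

(** Over [c] the map [f \o phi] equals [sigma \o f], a homeomorphism onto an open
    cell of the model, so [connected_over_cell] applies to the image by [phi]. *)
Lemma phi_subcell E c j : open_cells K E -> model_sub F j c -> c `<=` f @` E ->
  exists2 k, K k (phi @` (E `&` f @^-1` c)) &
   exists d, [/\ model_cells F k d, homeo_on c d sigma &
     forall k', model_cells F k' d -> k' = j].
Proof.
move=> KE Lc cfE; have [_ _ /(_ _ KE)[e' Fe' hE]] := hf.
have [h [hfE fhe ch]] := homeo_inv hE.
have fEe : f @` E `<=` e' by move=> _ [x Ex <-]; case: hE => -[+ _ _] _ _; apply.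
have ce' : c `<=` e' by exact: subset_trans fEe.
have oLc : open_cells (model_sub F) c by exists j.
have Ac : E `&` f @^-1` c = h @` c.
  apply/seteqP; split => [x [Ex fx]|_ [y cy <-]].
    by exists (f x) => //; exact: hfE.
  by have [Eh fh] := fhe _ (ce' _ cy); split => //; rewrite /= fh.
have [_ _ /(_ _ oLc)[d [k _ Fkd] hd]] := @sigma_cell_map _ F.
exists k; last first.
  exists d; split => // k' Fk'd; exact/esym/(homeo_cell_dim cL cF Lc Fk'd hd).
apply: (connected_over_cell cK cF hf Fkd).
  rewrite Ac; apply: connected_continuous_connected; last exact: continuous_subspaceT.
  apply: connected_continuous_connected; first exact: (cell_connected cL).
  exact: continuous_subspaceW ch.
have [[cd _ cs] _ _] := hd.
apply/seteqP; split => [_ [_ [x [Ex fx] <-] <-]|y /cs [z cz <-]].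
  by rewrite -sf_pt; exact: cd.
have [x Ex xz] := cfE _ cz; exists (phi x); last by rewrite -sf_pt xz.
by exists x => //; split => //=; rewrite xz.
Qed.

Lemma open_2cell E : K 2%N E -> open E.
Proof.
move=> KE; rewrite -(setCK E).
have -> : ~` E = \bigcup_(c in open_cells K `\ E) c.
  apply/seteqP; split => [x nEx|x [c [Kc ncE] cx] Ex].
    have [c Kc cx] := cell_of cK x; exists c => //; split => // cE.
    by apply: nEx; rewrite -cE.
  by apply: ncE; apply: (cell_uniq cK Kc _ cx Ex); exists 2%N.
apply: closed_openC; apply: (closed_cells_closed cK); first by move=> ? [].
move=> c [[j _ Kjc] ncE] x; have [_ _ _ [C [_ CK clC]]] := cell_facts cK Kjc.
move=> /clC [cx|[c' /CK [i /= ij Kic'] c'x]].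
  by exists c => //; split => //; exists j.
exists c' => //; split=> [|cE]; first by exists i.
rewrite cE in Kic'; have i2 := cell_dim_uniq cK Kic' KE.
by have := leq_trans ij (cw_dim_le2 cK Kjc); rewrite i2 ltnn.
Qed.

(** The subdivided cell around a point of [psi @` e] is carried by [phi] onto a
    cell that meets [e], hence onto [e]. It is therefore open, and since open
    tiles are dense it cannot lie in an edge. *)
Lemma parent_subcell e : K 2%N e -> exists E c, [/\ K 2%N E, model_sub F 2%N c,
  c `<=` f @` E & psi @` e = E `&` f @^-1` c].
Proof.
move=> Ke; have [x ex] : e !=set0 by apply: (cell_nonempty cK); exists 2%N.
have [E KE Ey] := cell_of cK (psi x).
have [e' Fe' hE] : exists2 e', open_cells (model_cells F) e' & homeo_on E e' f.
  by case: hf => _ _; apply.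
have [c [j _ Lc] cy] := cell_of cL (f (psi x)).
have ce' : c `<=` f @` E.
  have [_ /(_ c)[|d Fd cd]] := @model_subdivides _ F; first by exists j.
  have [[Ee' _ Es] _ _] := hE.
  have -> : f @` E = e'.
    by apply/seteqP; split => [_ [y' Ey' <-]|y' /Es//]; exact: Ee'.
  by rewrite (cell_uniq cF Fe' Fd _ (cd _ cy)) //; exact: Ee'.
have [k Kk [d [Fd _ dimd]]] := phi_subcell KE Lc ce'.
set A := E `&` f @^-1` c in Kk.
have phiA : phi @` A = e.
  apply: (cell_uniq cK _ _ _ ex); [by exists k|by exists 2%N|].
  by exists (psi x).
have k2 : k = 2%N by apply: (cell_dim_uniq cK Kk); rewrite phiA.
have j2 : j = 2%N by rewrite -(dimd k) // k2.
have psie : psi @` e = A.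
  rewrite -phiA; apply/seteqP; split => [_ [_ [y Ay <-] <-]|y Ay].
    by rewrite phiK.
  by exists (phi y); [exists y|rewrite phiK].
exists E, c; rewrite -j2; split => //.
have oA : open A.
  rewrite -psie (_ : psi @` e = phi @^-1` e).
    by apply: open_comp => //; exact: open_2cell.
  apply/seteqP; split => [_ [y ey <-]|y ey]; first by rewrite /= psiK.
  by exists (phi y) => //; rewrite phiK.
have Ay : A (psi x) by [].
have [_ [E' KE' <-] clE'] : (\bigcup_(t in closed_cells K 2%N) t) (psi x).
  by case: hK => _ -> _.
have [y [E'y [Ey' _]]] := clE' _ (open_nbhs_nbhs (conj oA Ay)).
by rewrite j2 (cell_uniq cK KE _ Ey' E'y) //; exists 2%N.
Qed.

(** Iterating [parent_subcell]. The second property transports the iterated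
    subdivision of the model, to which the mesh hypothesis applies, to the
    complex. *)
Lemma ancestor n e : K 2%N e -> exists2 E, K 2%N E &
  iter n psi @` e `<=` E /\
  iter_subdivision n (model_cells F) idfun 2%N (f @` (iter n psi @` e)).
Proof.
elim: n e => [|n IHn] e Ke.
  exists e => //; rewrite /= image_id; split => //.
  have [c Fc [[ec _ ce] _ _]] := tile_type hK Ke.
  suff -> : f @` e = c by [].
  by apply/seteqP; split => [_ [y ey <-]|y /ce//]; exact: ec.
have [E1 [c [KE1 Lc cf pe]]] := parent_subcell Ke.
have [E KE [sE it]] := IHn _ KE1.
have se : iter n.+1 psi @` e = iter n psi @` (psi @` e).
  apply/seteqP; split => [_ [x ex <-]|_ [_ [x ex <-] <-]].
    by exists (psi x); [exists x|rewrite iterSr].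
  by exists x => //; exact: iterSr.
have itK y : iter n phi (iter n psi y) = y.
  by elim: n {IHn it sE se} y => //= n IHn y; rewrite -iterS iterSr /= psiK.
exists E => //; split.
  by rewrite se pe => _ [x [E1x _] <-]; apply: sE; exists x.
exists (f @` (iter n psi @` E1)), c; split => //; first by exists 2%N.
  move=> y /cf [x E1x <-]; exists (f (iter n psi x)).
    by exists (iter n psi x) => //; exists x.
  by rewrite /= -f_iter_phi itK.
rewrite se pe; apply/seteqP; split.
  move=> _ [_ [x [E1x cx] <-] <-]; split.
    by exists (iter n psi x) => //; exists x.
  by rewrite /= -f_iter_phi itK.
move=> _ [[_ [x E1x <-] <-]]; rewrite /= -f_iter_phi itK => cx.
by exists (iter n psi x) => //; exists x.
Qed.

(** The model is compact, being a finite union of closed cells, so that its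
    subdivision is finite. *)
Lemma finite_iter_subdivision n :
  finite_set (open_cells (iter_subdivision n (model_cells F) idfun)).
Proof.
have cpt : compact [set: F].
  rewrite -(@model_union _ F) (_ : closed_cells _ _ =
    closure @` model_cells F 2%N) // bigcup_image.
  have fc : finite_set (model_cells F 2%N).
    by apply: sub_finite_set (@model_finite _ F) => e Fe; exists 2%N.
  rewrite -bigsetU_fset_set //; rewrite big_seq.
  apply: bigsetU_compact => e; rewrite in_fset_set // inE => Fe.
  by apply: (cell_compact cF); exists 2%N.
have fL : finite_set (open_cells (model_sub F)).
  apply: sub_finite_set (compact_finite_cells cL cpt) => e Le; split => //.
  by have [x ex] := cell_nonempty cL Le; exists x.
elim: n => [|n IHn] /=; first exact: model_finite.
apply: (@sub_finite_set _ _ ((fun p : set F * set F =>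
  p.1 `&` (iter n sigma \o idfun) @^-1` p.2) @`
  (open_cells (iter_subdivision n (model_cells F) idfun)
    `*` open_cells (model_sub F)))).
  move=> _ [k _ [e [c [he hc _ ->]]]]; exists (e, c) => //; split => //=.
  by exists k.
by apply: finite_image; exact: finite_setX.
Qed.

End Expansion.

(** * Counting tiles *)

Lemma card_fset_inj_pair (T U V : choiceType) (A : set T) (B : set U)
    (C : set V) (g : T -> U) (k : T -> V) :
  finite_set A -> finite_set B -> finite_set C ->
  (forall x, A x -> B (g x)) -> (forall x, A x -> C (k x)) ->
  (forall x y, A x -> A y -> g x = g y -> k x = k y -> x = y) ->
  (#|` fset_set A| <= #|` fset_set B| * #|` fset_set C|)%N.
Proof.
move=> fA fB fC gB kC inj.
have inA x : x \in fset_set A -> A x by rewrite in_fset_set // inE.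
rewrite -[X in (X <= _)%N](size_map (fun x => (g x, k x))).
rewrite -(size_allpairs pair); apply: uniq_leq_size.
  rewrite map_inj_in_uniq ?fset_uniq // => x y /inA Ax /inA Ay [gxy kxy].
  exact: inj.
move=> _ /mapP [x /inA Ax ->]; apply/allpairsP; exists (g x, k x) => /=.
by split => //; rewrite in_fset_set // inE; [exact: gB|exact: kC].
Qed.

Section NearTiles.
Variables (X : topologicalType) (K : cell_structure X) (S : set X).

(** Touching at a vertex is allowed: unlike the adjacency of fat paths, this
    relation contracts under passing to ancestors. *)
Definition touches (e e' : set X) : Prop := closure e `&` closure e' !=set0.

Fixpoint near_tiles n : set (set X) :=
  if n is m.+1 then [set e | K 2%N e /\ exists2 e', near_tiles m e' & touches e e']
  else [set e | K 2%N e /\ closure e `<=` S].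

Lemma near_tiles_sub n : near_tiles n `<=` K 2%N.
Proof. by case: n => [|n] e []. Qed.

Hypothesis K0 : forall k e, K k e -> e !=set0.

Lemma near_tilesS n : near_tiles n `<=` near_tiles n.+1.
Proof.
move=> e ne; have Ke := near_tiles_sub ne; split => //; exists e => //.
by have [x ex] := K0 Ke; exists x; split; exact: subset_closure.
Qed.

Lemma near_tiles_le m n : (m <= n)%N -> near_tiles m `<=` near_tiles n.
Proof.
move=> /subnKC <-; elim: (n - m)%N => [|d IHd]; first by rewrite addn0.
by rewrite addnS; apply: subset_trans IHd _; exact: near_tilesS.
Qed.

Lemma fat_ball_sub n : fat_ball K S n `<=` closure @` near_tiles n.
Proof.
have path i t_ m : (i <= m)%N -> (forall i, (i <= m)%N -> closed_cells K 2 (t_ i)) ->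
    t_ 0%N `<=` S ->
    (forall i, (i < m)%N -> exists2 a, closed_cells K 1 a & a `<=` t_ i `&` t_ i.+1) ->
    exists2 e, near_tiles i e & closure e = t_ i.
  move=> + tK t0 ta; elim: i => [_|i IHi im].
    by have [e Ke et] := tK 0%N isT; exists e => //; split => //; rewrite et.
  have [e0 ne0 e0t] := IHi (ltnW im); have [e Ke et] := tK _ im.
  exists e => //; split => //; exists e0 => //.
  have [_ [a Ka <-] at_] := ta _ im; have [x ax] := K0 Ka.
  by have [? ?] := at_ _ (subset_closure ax); exists x; rewrite et e0t.
move=> t [[e Ke <-] [k kn [[eS _]|[_ _ [t_ [tK t0 tk ta]] _]]]].
  by exists e => //; apply: (near_tiles_le (leq0n n)).
have [e' ne' e't] := path k t_ k (leqnn k) tK t0 ta.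
by exists e'; [exact: near_tiles_le ne'|rewrite e't].
Qed.

End NearTiles.

Section Plane.
Variables (R : realType) (X : topologicalType).
Variables (h : X -> 'rV[R]_2) (h' : 'rV[R]_2 -> X).
Hypothesis hh : mutually_inverse_homeos h h'.

(** Planarity makes the complex regular and locally finite. *)
Lemma plane_compact_nbhs (C : set X) : compact C ->
  exists V, compact V /\ forall x, C x -> nbhs x V.
Proof.
have [ch ch' hK h'K] := hh => cC.
have /compact_bounded [M0 [_ hM0]] : compact (h @` C).
  by apply: continuous_compact => //; exact: continuous_subspaceT.
pose M := M0 + 1; have hM y : (h @` C) y -> `|y| <= M.
  by apply: hM0; rewrite ltrDl.
pose B := [set y : 'rV[R]_2 | `|y| <= M + 1].
exists (h' @` B); split.
  apply: continuous_compact; first exact: continuous_subspaceT.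
  apply: bounded_closed_compact.
    exists (M + 1); split; first exact: num_real.
    by move=> r Mr y By; exact: le_trans By (ltW Mr).
  rewrite (_ : B = Num.norm @^-1` [set r | r <= M + 1]) //.
  by apply: closed_comp; [move=> y _; exact: norm_continuous|exact: closed_le].
move=> x Cx; have nB : nbhs (h x) B.
  apply: filterS (nbhsx_ballx (h x) 1 ltr01) => y.
  rewrite -ball_normE /ball_ /B /= => hy.
  have hx : `|h x| <= M by apply: hM; exists x.
  have : `|y| <= `|h x| + `|h x - y|.
    rewrite -{1}(subKr (h x) y); exact: ler_normB.
  lra.
have nhB : nbhs x (h @^-1` B) by exact: ch.
by apply: filterS nhB => y By; exists (h y).
Qed.

Lemma plane_regular : hausdorff_space X -> regular_space X.
Proof.
move=> hX x; have [V [cV nV]] := plane_compact_nbhs (@compact_set1 X x).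
exact: compact_regular hX cV (nV _ erefl).
Qed.

Variable K : cell_structure X.
Hypothesis cK : cw2_complex R K.

Lemma finite_touching (C : set X) : compact C ->
  finite_set [set e | K 2%N e /\ closure e `&` C !=set0].
Proof.
move=> /plane_compact_nbhs [V [cV nV]].
apply: sub_finite_set (compact_finite_cells cK cV) => e [Ke [x [ex Cx]]].
by split; [exists 2%N|exact: ex (nV _ Cx)].
Qed.

Lemma finite_near_tiles (S : set X) n : compact S -> finite_set (near_tiles K S n).
Proof.
move=> cS; elim: n => [|n IHn].
  apply: sub_finite_set (finite_touching cS) => e [Ke eS]; split => //.
  by have [x ex] := cell_nonempty cK (ex_intro2 _ _ 2%N I Ke); exists x;
    split; [|apply: eS]; exact: subset_closure.
apply: (@sub_finite_set _ _ (\bigcup_(e' in near_tiles K S n)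
  [set e | K 2%N e /\ touches e e'])) => [e [Ke [e' ne' t]]|].
  by exists e'.
apply: bigcup_finite => // e' /near_tiles_sub Ke'; apply: finite_touching.
by apply: (cell_compact cK); exists 2%N.
Qed.

End Plane.

Section Contraction.
Variables (R : realType) (F : subdivision_rule R).
Variables (X : topologicalType) (K : cell_structure X) (f : X -> F).
Variables (phi psi : X -> X) (S : set X).
Hypothesis hmesh : mesh_to_zero F.
Hypothesis hK : R_complex K f.
Hypothesis rX : regular_space X.
Hypotheses (cphi : continuous phi) (cpsi : continuous psi).
Hypotheses (phiK : cancel phi psi) (psiK : cancel psi phi).
Hypothesis sf : sigma \o f = f \o phi.

Let cK : cw2_complex R K. Proof. by case: hK. Qed.

Let cpsin n : continuous (iter n psi).
Proof.
elim: n => [|n IHn] x /=; first exact: cvg_id.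
by apply: continuous_comp; [exact: IHn|exact: cpsi].
Qed.

(** When the mesh is fine enough, a tile of the [N]-th subdivision is confined
    to a small part of its ancestor, so that the two ancestors that it connects
    already have a point in common. *)
Lemma contraction : exists N, forall e0 e1 e2 E0 E1 E2,
  K 2%N e0 -> K 2%N e1 -> K 2%N e2 -> K 2%N E0 -> K 2%N E1 -> K 2%N E2 ->
  iter N psi @` e0 `<=` E0 -> iter N psi @` e1 `<=` E1 ->
  iter N psi @` e2 `<=` E2 -> touches e0 e1 -> touches e1 e2 -> touches E0 E2.
Proof.
have [||N _ hN] := hmesh (cover := [set U | open U /\ localizing U]).
- by move=> U [].
- by apply/seteqP; split => // z _; have [U [? ? ?]] := localizing_cover z; exists U.
exists N => e0 e1 e2 E0 E1 E2 Ke0 Ke1 Ke2 KE0 KE1 KE2 s0 s1 s2 [x [x0 x1]] [y [y1 y2]].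
have [E KE [sE it]] := ancestor hK cphi phiK psiK sf N Ke1.
have [U [oU lU] fU] := hN _ (ex_intro2 _ _ _ it erefl).
have im e z : closure e z -> closure (iter N psi @` e) (iter N psi z).
  by move=> ez V /cpsin /ez [w [ew Vw]]; exists (iter N psi w); split => //; exists w.
have cs1 : connected (iter N psi @` e1).
  apply: connected_continuous_connected.
    by apply: (cell_connected cK); exists 2%N.
  by apply: continuous_subspaceT; exact: cpsin.
have sU := subset_trans (@subset_closure _ _) fU.
have [a [b [[Ka ax] [Kb bY] [v [av bv]]]]] :=
  localizing_tile hK rX lU KE1 s1 cs1 sU (im _ _ x1) (im _ _ y1).
exists v; split.
- apply: (cell_sub_tile hK rX KE0 Ka) av; exists (iter N psi x); split => //.
  exact: closureS s0 _ (im _ _ x0).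
- apply: (cell_sub_tile hK rX KE2 Kb) bv; exists (iter N psi y); split => //.
  exact: closureS s2 _ (im _ _ y2).
Qed.

Hypothesis subS : subcomplex K S.
Hypothesis phiS : S `<=` phi @` S.
Hypothesis fin_near : forall n, finite_set (near_tiles K S n).

(** A tile is determined by its ancestor and by the cell of the iterated
    subdivision of the model over which its image lies. *)
Lemma near_tiles_doubling : exists M, forall r,
  (#|` fset_set (near_tiles K S r.*2)| <= #|` fset_set (near_tiles K S r)| * M)%N.
Proof.
have [N hN] := contraction.
pose Q := open_cells (iter_subdivision N (model_cells F) idfun).
exists #|` fset_set Q| => r.
have ancP e : exists E, K 2%N e -> [/\ K 2%N E, iter N psi @` e `<=` E &
    Q (f @` (iter N psi @` e))].
  have [Ke|] := pselect (K 2%N e); last by exists set0.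
  have [E KE [sE it]] := ancestor hK cphi phiK psiK sf N Ke.
  by exists E => _; split => //; exists 2%N.
have [anc hanc] := choice ancP.
have psiS x : S x -> S (iter N psi x).
  by move=> Sx; elim: N {hN Q ancP anc hanc} => //= n /phiS [y Sy <-]; rewrite phiK.
have near_anc m e : near_tiles K S m.*2 e -> near_tiles K S m (anc e).
  elim: m e => [|m IHm] e; last first.
    rewrite doubleS => -[Ke [e1 [Ke1 [e2 ne2 t12]] t01]].
    have Ke2 := near_tiles_sub ne2.
    have [KE sE _] := hanc _ Ke; have [KE1 sE1 _] := hanc _ Ke1.
    have [KE2 sE2 _] := hanc _ Ke2; split => //; exists (anc e2); first exact: IHm.
    exact: hN sE sE1 sE2 t01 t12.
  move=> [Ke eS]; have [KE sE _] := hanc _ Ke; split => //.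
  have [x ex] := cell_nonempty cK (ex_intro2 _ _ 2%N I Ke).
  have Ex : anc e (iter N psi x) by apply: sE; exists x.
  have Sx : S (iter N psi x) by apply: psiS; apply: eS; exact: subset_closure.
  have [C CK [SE Ccl]] := subS; move: Sx; rewrite SE => -[c Cc cx].
  rewrite -SE; suff -> : anc e = c by exact: Ccl.
  by apply: (cell_uniq cK _ (CK _ Cc) Ex cx); exists 2%N.
apply: (card_fset_inj_pair (g := anc) (k := fun e => f @` (iter N psi @` e))) => //.
- exact: finite_iter_subdivision.
- by move=> e; exact: near_anc.
- by move=> e /near_tiles_sub /hanc [].
have itK x : iter N phi (iter N psi x) = x.
  elim: N {hN Q ancP anc hanc psiS near_anc} x => //= n IHn x.
  by rewrite -iterS iterSr /= psiK.
have sub e e' : K 2%N e -> K 2%N e' -> anc e = anc e' ->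
    f @` (iter N psi @` e) = f @` (iter N psi @` e') -> e `<=` e'.
  move=> Ke Ke' aa ff x ex.
  have [KE sE _] := hanc _ Ke; have [_ sE' _] := hanc _ Ke'.
  have : (f @` (iter N psi @` e)) (f (iter N psi x)).
    by exists (iter N psi x) => //; exists x.
  rewrite ff => -[_ [y ey <-] fyx].
  suff : iter N psi x = iter N psi y by move/(congr1 (iter N phi)); rewrite !itK => ->.
  apply: (cell_map_inj hK (ex_intro2 _ _ 2%N I KE)) => //.
    by apply: sE; exists x.
  by rewrite aa; apply: sE'; exists y.
move=> e e' /near_tiles_sub Ke /near_tiles_sub Ke' aa ff.
by apply/seteqP; split; apply: sub.
Qed.

End Contraction.

(** * Polynomial growth *)

Lemma doubling_growth (beta : nat -> nat) (M : nat) :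
  (forall m n, (m <= n)%N -> (beta m <= beta n)%N) ->
  (forall r, (beta r.*2 <= beta r * M)%N) ->
  forall n, (0 < n)%N -> (beta n <= beta 1%N * M ^ (trunc_log 2 n).+1)%N.
Proof.
move=> mono dbl n n0; have /= /andP[_ /ltnW n2] := trunc_log_bounds (ltnSn 1) n0.
apply: leq_trans (mono _ _ n2) _; elim: (trunc_log 2 n).+1 => [|k IHk].
  by rewrite !expn0 muln1.
rewrite expnS mul2n; apply: leq_trans (dbl _) _.
by rewrite expnSr mulnA leq_mul2r IHk orbT.
Qed.

Lemma doubling_polynomial_growth (R : realType) (b beta : nat -> nat) (M : nat) :
  (forall n, (b n <= beta n)%N) ->
  (forall m n, (m <= n)%N -> (beta m <= beta n)%N) ->
  (forall r, (beta r.*2 <= beta r * M)%N) ->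
  polynomial_growth R b.
Proof.
move=> bb mono dbl; pose u n : \bar R := (ln (b n)%:R / ln n%:R)%:E.
have ln_ge0N n : 0 <= ln n%:R :> R.
  by case: n => [|n]; [rewrite ln0|apply: ln_ge0; rewrite ler1n].
have u0 n : (0 <= u n)%E by rewrite lee_fin divr_ge0.
pose A : R := ln M.+1%:R; pose B : R := ln (beta 1%N).+1%:R.
have ln2 : 0 < ln 2 :> R by apply: ln_gt0; rewrite ltr1n.
have A0 : 0 <= A by exact: ln_ge0N.
have B0 : 0 <= B by exact: ln_ge0N.
(* With [2 ^ k <= m < 2 ^ k.+1] the bound is [ln (b m) <= B + k.+1 * A], while
   [k * ln 2] and [ln 2] are at most [ln m]. *)
pose C := (A * 2 + B) / ln 2.
have uC n : (u n <= C%:E)%E.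
  rewrite lee_fin; have C0 : 0 <= C.
    apply: divr_ge0; last exact: ltW.
    by apply: addr_ge0 => //; exact: mulr_ge0.
  case: n => [|[|n]].
  - by rewrite (@ln0 _ 0%:R) ?invr0 ?mulr0.
  - by rewrite ln1 invr0 mulr0.
  set m := n.+2.
  have m2 : ln 2 <= ln m%:R :> R.
    by rewrite ler_ln ?posrE ?ltr0n // ler_nat.
  have lm : 0 < ln m%:R :> R by exact: lt_le_trans m2.
  rewrite ler_pdivrMr // /C mulrAC ler_pdivlMr //.
  have [->|bm] := posnP (b m).
    rewrite ln0 // mul0r; apply: mulr_ge0; last exact: ltW.
    by apply: addr_ge0 => //; exact: mulr_ge0.
  set k := trunc_log 2 m.
  have km : k%:R * ln 2 <= ln m%:R :> R.
    rewrite mulr_natl -lnXn ?ltr0n // -natrX ler_ln ?posrE ?ltr0n ?expn_gt0 //.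
    by rewrite ler_nat; apply: trunc_logP.
  have lb : ln (b m)%:R <= B + k.+1%:R * A.
    rewrite mulr_natl -lnXn ?ltr0n // -natrX -lnM ?posrE ?ltr0n ?expn_gt0 //.
    rewrite -natrM ler_ln; last 2 first.
    - by rewrite posrE ltr0n.
    - by rewrite posrE ltr0n muln_gt0 expn_gt0.
    rewrite ler_nat.
    apply: leq_trans (bb m) _; apply: leq_trans (doubling_growth mono dbl _) _ => //.
    by apply: leq_mul => //; rewrite leq_exp2r.
  apply: le_trans (ler_wpM2r (ltW ln2) lb) _.
  have : B * ln 2 <= B * ln m%:R by exact: ler_wpM2l.
  have : A * (k%:R * ln 2) <= A * ln m%:R by exact: ler_wpM2l.
  have : A * ln 2 <= A * ln m%:R by exact: ler_wpM2l.
  rewrite -(natr1 k); lra.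
have ge0 : (0 <= limn_esup u)%E.
  apply: limf_esup_ge0 => //; exact: filter_not_empty.
have leC : (limn_esup u <= C%:E)%E.
  rewrite /limn_esup limf_esupE; apply: (@le_trans _ _ (ereal_sup (u @` setT))).
    by apply: ereal_inf_lbound; exists setT => //; exact: filterT.
  by apply: ge_ereal_sup => _ [n _ <-].
exists (fine (limn_esup u)); rewrite /polynomial_growth_of_degree -/u fineK //.
by rewrite ge0_fin_numE // (le_lt_trans leC) // ltry.
Qed.

(* [growth_coef K S n] is the cardinal of the set of tiles [fat_ball K S n]
   only when that set is finite, so finiteness is stated as well. *)
Theorem corollary2 (R : realType) (F : subdivision_rule R)
    (X : topologicalType) (K : cell_structure X) (f : X -> F) (phi : X -> X)
    (S : set X)
    (hvalence : bounded_valence F)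
    (hmesh : mesh_to_zero F)
    (hX : expansion_complex K f phi)
    (hS : seed R K phi S) :
  (forall n, finite_set (fat_ball K S n)) /\
  polynomial_growth R (growth_coef K S).
Proof.
have [hK [psi [cphi cpsi phiK psiK]] [h [h' [hh _]]] sf] := hX.
have [subS [d [[dS _ dsurj] cd _]] Sphi _] := hS.
have cK : cw2_complex R K by case: hK.
have cS : compact S.
  have -> : S = d @` cdisk R 2.
    by apply/seteqP; split => [x /dsurj//|_ [x dx <-]]; exact: dS.
  by apply: continuous_compact => //; exact: cdisk_compact.
have K0 k e : K k e -> e !=set0.
  by move=> Ke; apply: (cell_nonempty cK); exists k.
have rX := plane_regular hh (cw_hausdorff cK).
have fnear n := finite_near_tiles hh cK n cS.
have fball n : finite_set (fat_ball K S n).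
  apply: (@sub_finite_set _ _ (closure @` near_tiles K S n)); first exact: fat_ball_sub.
  exact: finite_image.
split=> //.
have [M hM] := near_tiles_doubling hmesh hK rX cphi cpsi phiK psiK sf subS Sphi fnear.
apply: (@doubling_polynomial_growth _ _
  (fun n => #|` fset_set (near_tiles K S n)|%N) M) => //.
- move=> n; rewrite /growth_coef.
  apply: leq_trans (_ : (#|` fset_set (closure @` near_tiles K S n)| <= _)%N).
    apply: fsubset_leq_card; rewrite -fset_set_sub //; last exact: finite_image.
    exact: fat_ball_sub.
  by rewrite fset_set_image //; exact: leq_imfset_card.
- move=> m n mn; apply: fsubset_leq_card; rewrite -fset_set_sub //.
  exact: near_tiles_le.
Qed.
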